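(* Let $D$ be an integral domain. (1) Assume that there exists a $D$-$D$-biring structure on $\operatorname{Int}(D)$ compatible with that on $D[X]$. Then the functors $\operatorname{Hom}_D(\operatorname{Int}(D),-)$ and $\operatorname{Int}(D)\odot_D-$ are right and left adjoints, respectively, of the inclusion from $D$-torsion-free WPC $D$-algebras to $D$-algebras if and only if the $D$-algebras $\operatorname{Hom}_D(\operatorname{Int}(D),A)$ and $\operatorname{Int}(D)\odot_DA$ are $D$-torsion-free for every $D$-algebra $A$. (2) If $D$ is a PID with all residue fields finite, then there exists a $D$-$D$-biring structure on $\operatorname{Int}(D)$ compatible with that on $D[X]$, and the $D$-algebras $\operatorname{Hom}_D(\operatorname{Int}(D),A)$ and $\operatorname{Int}(D)\odot_DA$ are $D$-torsion-free for every $D$-algebra $A$; therefore the functors $\operatorname{Hom}_D(\operatorname{Int}(D),-)$ and $\operatorname{Int}(D)\odot_D-$ are right and left adjoints, respectively, of the inclusion from $D$-torsion-free WPC $D$-algebras to $D$-algebras.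
   Context: All rings and algebras are commutative with identity. For an integral domain $D$ with quotient field $K$, $\operatorname{Int}(D)=\{f\in K[X] : f(D)\subseteq D\}$. A $D$-algebra $A$ is $D$-torsion-free if $da=0$ with $d\in D\setminus\{0\}$ implies $a=0$. A $D$-algebra $A$ is weakly polynomially complete (WPC) if for every $a\in A$ there is a $D$-algebra homomorphism $\operatorname{Int}(D)\to A$ sending $X$ to $a$. The category of $D$-torsion-free WPC $D$-algebras is the full subcategory of $D$-algebras on these objects. Residue fields of $D$ are the fields $D/\mathfrak m$, $\mathfrak m$ maximal. Birings. An $A$-$B$-biring is an $A$-algebra $S$ together with the structure on $S$ of a $B$-algebra object in the opposite category of the category of $A$-algebras: $A$-algebra homomorphisms $\Delta^+,\Delta^\times:S\to S\otimes_AS$ (co-addition, co-multiplication) and a co-$B$-linear structure $\beta:B\to\operatorname{Hom}_A(S,A)$ satisfying the duals of the laws defining $B$-algebras. Equivalently, it is a lift of the functor $\operatorname{Hom}_A(S,-)$ ($A$-algebra homomorphisms) to a functor from $A$-algebras to $B$-algebras: the sum (resp. product) of $\varphi,\psi\in\operatorname{Hom}_A(S,R)$ is the composite of $\Delta^+$ (resp. $\Delta^\times$) with $s\otimes t\mapsto\varphi(s)\psi(t)$, and $b\in B$ maps to $S\xrightarrow{\beta(b)}A\to R$. Homomorphisms of birings are $A$-algebra homomorphisms compatible with this structure. $A[X]$ is an $A$-$A$-biring with $\Delta^+(X)=X\otimes1+1\otimes X$, $\Delta^\times(X)=X\otimes X$, $\beta(a)(f)=f(a)$. A $D$-$D$-biring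 structure on $\operatorname{Int}(D)$ is compatible with that on $D[X]$ if the inclusion $D[X]\to\operatorname{Int}(D)$ is a homomorphism of $D$-$D$-birings. For an $A$-$B$-biring $S$, the lifted functor $\operatorname{Hom}_A(S,-)$ from $A$-algebras to $B$-algebras has a left adjoint $S\odot_A-$. For a $B$-algebra $R$, $S\odot_AR$ is the $A$-algebra generated by symbols $s\odot r$ ($s\in S$, $r\in R$) subject to: for each $r$, $s\mapsto s\odot r$ is an $A$-algebra homomorphism; $s\odot(r+r')=\sum_i(s_i\odot r)(s_i'\odot r')$ where $\Delta^+(s)=\sum_is_i\otimes s'_i$; $s\odot(rr')=\sum_i(t_i\odot r)(t_i'\odot r')$ where $\Delta^\times(s)=\sum_it_i\otimes t'_i$; and $s\odot b=\beta(b)(s)$ for $b\in B$. In the claim, $\operatorname{Hom}_D(\operatorname{Int}(D),-)$ (as a functor to $D$-algebras) and $\operatorname{Int}(D)\odot_D-$ are formed with respect to the compatible $D$-$D$-biring structure on $\operatorname{Int}(D)$. *)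

(* Defs.v *)
From HB Require Import structures.
From mathcomp Require Import all_boot all_algebra.
From mathcomp Require Import boolp classical_sets functions cardinality.

Set Implicit Arguments.
Unset Strict Implicit.
Unset Printing Implicit Defensive.

Import GRing.Theory.
Local Open Scope ring_scope.

(* The library's [comAlgType R] only contains nonzero algebras. The zero
   algebra is needed here: for example Int(Z) (.) F_p is zero. Hence an
   R-algebra is a commutative ring, possibly zero, with a structure map. *)
Record calg (R : comPzRingType) := CAlg {
  calg_ring :> comPzRingType;
  algmap : {rmorphism R -> calg_ring} }.
Arguments algmap {R} _.

Definition calg_self (R : comPzRingType) : calg R := CAlg (@idfun R).

Record ahom (R : comPzRingType) (P Q : calg R) := AHom {
  ahom_fun :> {rmorphism P -> Q};
  ahomC : forall r, ahom_fun (algmap P r) = algmap Q r }.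

Section AlgebraHom.
Context {R : comPzRingType}.
Implicit Types P Q S T : calg R.

Lemma ahomP P Q (f g : ahom P Q) : f =1 g <-> f = g.
Proof.
split=> [|->//]; case: f g => [f fC] [g gC] /= fg.
suff e : f = g by subst g; congr AHom; exact: Prop_irrelevance.
case: f g fg {fC gC} => [f [[f1] [f2]]] [g [[g1] [g2]]] /= fg.
have e : f = g by apply/funext.
by subst g; congr (GRing.RMorphism.Pack (GRing.RMorphism.Class _ _));
   congr (_ _); exact: Prop_irrelevance.
Qed.

Definition is_ahom P Q (f : P -> Q) : Prop :=
  [/\ {morph f : x y / x + y}, {morph f : x y / x * y}
    & forall r, f (algmap P r) = algmap Q r].

Section Build.
Variables (P Q : calg R) (f : P -> Q) (fP : is_ahom f).

Let f_zmod : zmod_morphism f.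
Proof.
case: fP => fD _ _ x y; apply: (addIr (f y)).
by rewrite -fD !subrK.
Qed.

Let f_monoid : monoid_morphism f.
Proof.
by case: fP => _ fM fC; split=> //; rewrite -(rmorph1 (algmap P)) fC rmorph1.
Qed.

Definition build_fun (x : P) : Q := f x.
HB.instance Definition _ := GRing.isZmodMorphism.Build P Q build_fun f_zmod.
HB.instance Definition _ := GRing.isMonoidMorphism.Build P Q build_fun f_monoid.

Definition build_ahom : ahom P Q :=
  @AHom R P Q build_fun (let: And3 _ _ h := fP in h).
End Build.

Arguments build_fun {P Q} f x /.

Lemma build_ahomE P Q (f : P -> Q) (fP : is_ahom f) x : build_ahom fP x = f x.
Proof. by []. Qed.

Definition ahom_id P : ahom P P := @AHom R P P (@idfun P) (fun=> erefl).

Lemma ahom_comp_subproof S P Q (g : ahom P Q) (f : ahom S P) r :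
  (g \o f) (algmap S r) = algmap Q r.
Proof. by rewrite /= !ahomC. Qed.

Definition ahom_comp S P Q (g : ahom P Q) (f : ahom S P) : ahom S Q :=
  @AHom R S Q (g \o f) (ahom_comp_subproof g f).

Definition ahom_unit P : ahom (calg_self R) P :=
  @AHom R (calg_self R) P (algmap P) (fun=> erefl).

End AlgebraHom.
Arguments build_fun {R P Q} f x /.

Notation "g \oa f" := (ahom_comp g f) (at level 50, left associativity).

Lemma ahom_compE (R : comPzRingType) (P Q S : calg R) (g : ahom P Q)
  (f : ahom S P) x : (g \oa f) x = g (f x).
Proof. by []. Qed.

Lemma ahom_idE (R : comPzRingType) (P : calg R) x : ahom_id P x = x.
Proof. by []. Qed.

Lemma ahom_unitE (R : comPzRingType) (P : calg R) x :
  ahom_unit P x = algmap P x.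
Proof. by []. Qed.

(* Instances of the [rmorph] lemmas that keep the coercion from [ahom]. *)
Section Rmorph.
Context {R : comPzRingType} {P Q : calg R} (f : ahom P Q).
Lemma ahomD x y : f (x + y) = f x + f y. Proof. exact: rmorphD. Qed.
Lemma ahomM x y : f (x * y) = f x * f y. Proof. exact: rmorphM. Qed.
Lemma ahomN x : f (- x) = - f x. Proof. exact: rmorphN. Qed.
Lemma ahom0 : f 0 = 0. Proof. exact: rmorph0. Qed.
Lemma ahom1 : f 1 = 1. Proof. exact: rmorph1. Qed.
End Rmorph.

Definition ahomE := (@ahom_compE, @ahom_idE, @ahom_unitE).

Lemma ahom_compA (R : comPzRingType) (P Q S T : calg R) (h : ahom S T)
  (g : ahom Q S) (f : ahom P Q) : h \oa (g \oa f) = h \oa g \oa f.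
Proof. exact/ahomP. Qed.

Lemma ahom_comp1l (R : comPzRingType) (P Q : calg R) (f : ahom P Q) :
  ahom_id Q \oa f = f.
Proof. exact/ahomP. Qed.

Lemma ahom_comp1r (R : comPzRingType) (P Q : calg R) (f : ahom P Q) :
  f \oa ahom_id P = f.
Proof. exact/ahomP. Qed.

Lemma ahom_comp_unit (R : comPzRingType) (P Q : calg R) (f : ahom P Q) :
  f \oa ahom_unit P = ahom_unit Q.
Proof. by apply/ahomP => r /=; rewrite ahomC. Qed.

(* [term R G] and [pres_eq] present the commutative R-algebra with generators G
   and given relations; the quotient may be zero. *)
Inductive term (R G : Type) : Type :=
| Gen of G
| Cst of R
| Add of term R G & term R G
| Opp of term R G
| Mul of term R G & term R G.
Arguments Gen {R G} _.
Arguments Cst {R G} _.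

HB.instance Definition _ R G := gen_eqMixin (term R G).
HB.instance Definition _ R G := gen_choiceMixin (term R G).

Section Presentation.
Variables (R : comPzRingType) (G : Type) (rel : term R G -> term R G -> Prop).
Local Notation tm := (term R G).

Inductive pres_eq : tm -> tm -> Prop :=
| PRefl t : pres_eq t t
| PSym t u : pres_eq t u -> pres_eq u t
| PTrans t u v : pres_eq t u -> pres_eq u v -> pres_eq t v
| PAdd t t' u u' :
    pres_eq t t' -> pres_eq u u' -> pres_eq (Add t u) (Add t' u')
| POpp t t' : pres_eq t t' -> pres_eq (Opp t) (Opp t')
| PMul t t' u u' :
    pres_eq t t' -> pres_eq u u' -> pres_eq (Mul t u) (Mul t' u')
| PAddA t u v : pres_eq (Add t (Add u v)) (Add (Add t u) v)
| PAddC t u : pres_eq (Add t u) (Add u t)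
| PAdd0 t : pres_eq (Add (Cst 0) t) t
| PAddN t : pres_eq (Add (Opp t) t) (Cst 0)
| PMulA t u v : pres_eq (Mul t (Mul u v)) (Mul (Mul t u) v)
| PMulC t u : pres_eq (Mul t u) (Mul u t)
| PMul1 t : pres_eq (Mul (Cst 1) t) t
| PMulDl t u v : pres_eq (Mul (Add t u) v) (Add (Mul t v) (Mul u v))
| PCstD a b : pres_eq (Cst (a + b)) (Add (Cst a) (Cst b))
| PCstM a b : pres_eq (Cst (a * b)) (Mul (Cst a) (Cst b))
| PRel t u : rel t u -> pres_eq t u.

Definition pres_eqb (t u : tm) : bool := `[< pres_eq t u >].

Lemma pres_eqb_refl : reflexive pres_eqb.
Proof. by move=> t; apply/asboolP; exact: PRefl. Qed.

Lemma pres_eqb_sym : symmetric pres_eqb.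
Proof. by move=> t u; apply/asboolP/asboolP; exact: PSym. Qed.

Lemma pres_eqb_trans : transitive pres_eqb.
Proof.
by move=> u t v /asboolP tu /asboolP uv; apply/asboolP; exact: PTrans tu uv.
Qed.

Canonical pres_equiv :=
  EquivRel pres_eqb pres_eqb_refl pres_eqb_sym pres_eqb_trans.

Definition pres_car : Type := {eq_quot pres_equiv}%qT.
HB.instance Definition _ := Choice.on pres_car.

Definition pres_pi (t : tm) : pres_car :=
  (\pi_{eq_quot pres_equiv} t)%qT.
Definition pres_repr (x : pres_car) : tm := repr (x : {eq_quot pres_equiv}%qT).

Lemma pres_piP t u : pres_pi t = pres_pi u <-> pres_eq t u.
Proof.
split=> [/eqmodP/asboolP //|h]; by apply/eqmodP/asboolP.
Qed.

Lemma pres_reprK x : pres_pi (pres_repr x) = x.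
Proof. exact: reprK. Qed.

Lemma pres_repr_pi t : pres_eq (pres_repr (pres_pi t)) t.
Proof. by apply/pres_piP; rewrite pres_reprK. Qed.

Let add (x y : pres_car) := pres_pi (Add (pres_repr x) (pres_repr y)).
Let opp (x : pres_car) := pres_pi (Opp (pres_repr x)).
Let mul (x y : pres_car) := pres_pi (Mul (pres_repr x) (pres_repr y)).

Let addE t u : add (pres_pi t) (pres_pi u) = pres_pi (Add t u).
Proof. by apply/pres_piP; apply: PAdd; exact: pres_repr_pi. Qed.
Let oppE t : opp (pres_pi t) = pres_pi (Opp t).
Proof. by apply/pres_piP; apply: POpp; exact: pres_repr_pi. Qed.
Let mulE t u : mul (pres_pi t) (pres_pi u) = pres_pi (Mul t u).
Proof. by apply/pres_piP; apply: PMul; exact: pres_repr_pi. Qed.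

Let addA : associative add.
Proof.
move=> x y z; rewrite -(pres_reprK x) -(pres_reprK y) -(pres_reprK z) !addE.
by apply/pres_piP; exact: PAddA.
Qed.
Let addC : commutative add.
Proof. by move=> x y; apply/pres_piP; exact: PAddC. Qed.
Let add0 : left_id (pres_pi (Cst 0)) add.
Proof.
by move=> x; rewrite -(pres_reprK x) addE; apply/pres_piP; exact: PAdd0.
Qed.
Let addN : left_inverse (pres_pi (Cst 0)) opp add.
Proof.
by move=> x; rewrite -(pres_reprK x) oppE addE; apply/pres_piP; exact: PAddN.
Qed.
HB.instance Definition _ := GRing.isZmodule.Build pres_car addA addC add0 addN.

Let mulA : associative mul.
Proof.
move=> x y z; rewrite -(pres_reprK x) -(pres_reprK y) -(pres_reprK z) !mulE.
by apply/pres_piP; exact: PMulA.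
Qed.
Let mulC : commutative mul.
Proof. by move=> x y; apply/pres_piP; exact: PMulC. Qed.
Let mul1 : left_id (pres_pi (Cst 1)) mul.
Proof.
by move=> x; rewrite -(pres_reprK x) mulE; apply/pres_piP; exact: PMul1.
Qed.
Let mulDl : left_distributive mul add.
Proof.
move=> x y z; rewrite -(pres_reprK x) -(pres_reprK y) -(pres_reprK z).
by rewrite !(addE, mulE); apply/pres_piP; exact: PMulDl.
Qed.
HB.instance Definition _ :=
  GRing.Zmodule_isComPzRing.Build pres_car mulA mulC mul1 mulDl.

Lemma pres_piD t u : pres_pi (Add t u) = pres_pi t + pres_pi u.
Proof. exact: esym (addE t u). Qed.
Lemma pres_piM t u : pres_pi (Mul t u) = pres_pi t * pres_pi u.
Proof. exact: esym (mulE t u). Qed.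
Lemma pres_piN t : pres_pi (Opp t) = - pres_pi t.
Proof. exact: esym (oppE t). Qed.

Definition pres_cst (a : R) : pres_car := pres_pi (Cst a).

Let cst_zmod : zmod_morphism pres_cst.
Proof.
have cstD a b : pres_cst (a + b) = pres_cst a + pres_cst b.
  by rewrite -pres_piD; apply/pres_piP; exact: PCstD.
by move=> a b; apply: (addIr (pres_cst b)); rewrite -cstD !subrK.
Qed.
Let cst_monoid : monoid_morphism pres_cst.
Proof.
by split=> // a b; rewrite /pres_cst -pres_piM; apply/pres_piP; exact: PCstM.
Qed.
HB.instance Definition _ :=
  GRing.isZmodMorphism.Build R pres_car pres_cst cst_zmod.
HB.instance Definition _ :=
  GRing.isMonoidMorphism.Build R pres_car pres_cst cst_monoid.

Definition pres : calg R := @CAlg R (GRing.ComPzRing.clone pres_car _) pres_cst.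

Arguments pres : simpl never.

Definition pgen (g : G) : pres := pres_pi (Gen g).

Fixpoint term_eval (T : calg R) (v : G -> T) (t : tm) : T :=
  match t with
  | Gen g => v g
  | Cst a => algmap T a
  | Add t u => term_eval v t + term_eval v u
  | Opp t => - term_eval v t
  | Mul t u => term_eval v t * term_eval v u
  end.

Lemma term_eval_pgen t : term_eval (T := pres) pgen t = pres_pi t.
Proof.
elim: t => //= [t -> u ->|t ->|t -> u ->].
- by rewrite pres_piD.
- by rewrite pres_piN.
- by rewrite pres_piM.
Qed.

Lemma pres_rel t u : rel t u ->
  term_eval (T := pres) pgen t = term_eval (T := pres) pgen u.
Proof. by move=> tu; rewrite !term_eval_pgen; apply/pres_piP; exact: PRel. Qed.

Section Lift.
Variables (T : calg R) (v : G -> T).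
Hypothesis v_rel : forall t u, rel t u -> term_eval v t = term_eval v u.

Lemma term_eval_eq t u : pres_eq t u -> term_eval v t = term_eval v u.
Proof.
elim=> {t u} /=.
- by [].
- by move=> t u _ ->.
- by move=> t u w _ -> _ ->.
- by move=> t t' u u' _ -> _ ->.
- by move=> t t' _ ->.
- by move=> t t' u u' _ -> _ ->.
- by move=> *; rewrite addrA.
- by move=> *; rewrite addrC.
- by move=> *; rewrite rmorph0 add0r.
- by move=> *; rewrite rmorph0 addNr.
- by move=> *; rewrite mulrA.
- by move=> *; rewrite mulrC.
- by move=> *; rewrite rmorph1 mul1r.
- by move=> *; rewrite mulrDl.
- by move=> *; rewrite rmorphD.
- by move=> *; rewrite rmorphM.
- exact: v_rel.
Qed.

Definition pres_lift_fun (x : pres) : T := term_eval v (pres_repr x).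

Lemma pres_lift_pi t : pres_lift_fun (pres_pi t) = term_eval v t.
Proof. by apply: term_eval_eq; exact: pres_repr_pi. Qed.

Lemma pres_lift_subproof : is_ahom pres_lift_fun.
Proof.
split=> [x y|x y|a]; last by rewrite pres_lift_pi.
- by rewrite -(pres_reprK x) -(pres_reprK y) -pres_piD !pres_lift_pi.
- by rewrite -(pres_reprK x) -(pres_reprK y) -pres_piM !pres_lift_pi.
Qed.

Definition pres_lift : ahom pres T := build_ahom pres_lift_subproof.

Lemma pres_liftE g : pres_lift (pgen g) = v g.
Proof. by rewrite /= [LHS]pres_lift_pi. Qed.
End Lift.

Lemma pres_ext (T : calg R) (f h : ahom pres T) :
  (forall g, f (pgen g) = h (pgen g)) -> f = h.
Proof.
move=> fh; apply/ahomP => x; rewrite -(pres_reprK x) -term_eval_pgen.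
elim: (pres_repr x) => //= [a|t IHt u IHu|t IHt|t IHt u IHu].
- by rewrite (ahomC f) (ahomC h).
- by rewrite !rmorphD IHt IHu.
- by rewrite !rmorphN IHt.
- by rewrite !rmorphM IHt IHu.
Qed.

End Presentation.
Arguments pres : simpl never.

Section Tensor.
Context {R : comPzRingType}.
Implicit Types P Q S T : calg R.

Inductive tensor_rel P Q : term R (P * Q) -> term R (P * Q) -> Prop :=
| TensDl x x' y :
    tensor_rel (Gen (x + x', y)) (Add (Gen (x, y)) (Gen (x', y)))
| TensDr x y y' :
    tensor_rel (Gen (x, y + y')) (Add (Gen (x, y)) (Gen (x, y')))
| TensZl a x y :
    tensor_rel (Gen (algmap P a * x, y)) (Mul (Cst a) (Gen (x, y)))
| TensZr a x y :
    tensor_rel (Gen (x, algmap Q a * y)) (Mul (Cst a) (Gen (x, y)))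
| TensM x x' y y' :
    tensor_rel (Gen (x * x', y * y')) (Mul (Gen (x, y)) (Gen (x', y')))
| Tens1 : tensor_rel (Gen (1, 1)) (Cst 1).

Definition tensor P Q : calg R := pres (@tensor_rel P Q).
Arguments tensor : simpl never.
Definition tens P Q (x : P) (y : Q) : tensor P Q :=
  pgen (@tensor_rel P Q) (x, y).

Local Notation "x ⊗ y" := (tens x y) (at level 38, left associativity).

Lemma tensDl P Q (x x' : P) (y : Q) : (x + x') ⊗ y = x ⊗ y + x' ⊗ y.
Proof. exact: (pres_rel (TensDl x x' y)). Qed.
Lemma tensDr P Q (x : P) (y y' : Q) : x ⊗ (y + y') = x ⊗ y + x ⊗ y'.
Proof. exact: (pres_rel (TensDr x y y')). Qed.
Lemma tensZl P Q a (x : P) (y : Q) :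
  (algmap P a * x) ⊗ y = algmap (tensor P Q) a * (x ⊗ y).
Proof. exact: (pres_rel (TensZl a x y)). Qed.
Lemma tensZr P Q a (x : P) (y : Q) :
  x ⊗ (algmap Q a * y) = algmap (tensor P Q) a * (x ⊗ y).
Proof. exact: (pres_rel (TensZr a x y)). Qed.
Lemma tensM P Q (x x' : P) (y y' : Q) :
  (x * x') ⊗ (y * y') = (x ⊗ y) * (x' ⊗ y').
Proof. exact: (pres_rel (TensM x x' y y')). Qed.
Lemma tens1 P Q : (1 : P) ⊗ (1 : Q) = 1.
Proof. by rewrite [LHS](pres_rel (Tens1 P Q)) /= rmorph1. Qed.

Lemma tens0r P Q (x : P) : x ⊗ (0 : Q) = 0.
Proof. by apply: (addIr (x ⊗ 0)); rewrite -tensDr !add0r. Qed.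
Lemma tens0l P Q (y : Q) : (0 : P) ⊗ y = 0.
Proof. by apply: (addIr (0 ⊗ y)); rewrite -tensDl !add0r. Qed.

Lemma tens_split P Q (x : P) (y : Q) : x ⊗ y = (x ⊗ 1) * (1 ⊗ y).
Proof. by rewrite -tensM mulr1 mul1r. Qed.

Lemma tensor_sumP P Q (z : tensor P Q) :
  exists ps : seq (P * Q), z = \sum_(p <- ps) p.1 ⊗ p.2.
Proof.
pose tsum (ps : seq (P * Q)) : tensor P Q := \sum_(p <- ps) p.1 ⊗ p.2.
have N1 (x : P) (y : Q) : (- x) ⊗ y = - (x ⊗ y).
  by apply: (addIr (x ⊗ y)); rewrite -tensDl !addNr tens0l.
rewrite -(pres_reprK z) -term_eval_pgen.
elim: (pres_repr z) => /= [[x y]|a|t [ps ->] u [qs ->]|t [ps ->]|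
  t [ps ->] u [qs ->]].
- by exists [:: (x, y)]; rewrite big_seq1.
- exists [:: (algmap P a, 1)]; rewrite big_seq1 /=.
  by rewrite -[algmap P a]mulr1 tensZl tens1 mulr1.
- by exists (ps ++ qs); rewrite big_cat.
- exists [seq (- p.1, p.2) | p <- ps]; rewrite big_map -sumrN.
  by apply: eq_bigr => p _; rewrite N1.
- exists [seq (p.1 * q.1, p.2 * q.2) | p <- ps, q <- qs].
  rewrite big_allpairs_dep mulr_suml; apply: eq_bigr => p _.
  by rewrite mulr_sumr; apply: eq_bigr => q _; rewrite tensM.
Qed.

Lemma tensor_ext P Q T (f g : ahom (tensor P Q) T) :
  (forall x y, f (x ⊗ y) = g (x ⊗ y)) -> f = g.
Proof. by move=> fg; apply: pres_ext => -[x y]; exact: fg. Qed.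

Lemma tinl_subproof P Q : is_ahom (fun x : P => x ⊗ (1 : Q)).
Proof.
split=> [x y|x y|a]; first exact: tensDl.
- by rewrite -tensM mulr1.
- by rewrite -[algmap P a]mulr1 tensZl tens1 mulr1.
Qed.
Definition tinl P Q : ahom P (tensor P Q) := build_ahom (tinl_subproof P Q).
Lemma tinlE P Q x : tinl P Q x = x ⊗ 1. Proof. by []. Qed.

Lemma tinr_subproof P Q : is_ahom (fun y : Q => (1 : P) ⊗ y).
Proof.
split=> [x y|x y|a]; first exact: tensDr.
- by rewrite -tensM mulr1.
- by rewrite -[algmap Q a]mulr1 tensZr tens1 mulr1.
Qed.
Definition tinr P Q : ahom Q (tensor P Q) := build_ahom (tinr_subproof P Q).
Lemma tinrE P Q y : tinr P Q y = 1 ⊗ y. Proof. by []. Qed.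

Lemma tpair_subproof P Q T (f : ahom P T) (g : ahom Q T) t u :
  tensor_rel t u ->
  term_eval (fun p : P * Q => f p.1 * g p.2) t =
  term_eval (fun p : P * Q => f p.1 * g p.2) u.
Proof.
case=> [x x' y|x y y'|a x y|a x y|x x' y y'|] /=.
- by rewrite rmorphD mulrDl.
- by rewrite rmorphD mulrDr.
- by rewrite rmorphM ahomC mulrA.
- by rewrite rmorphM ahomC mulrCA.
- by rewrite !rmorphM mulrACA.
- by rewrite !rmorph1 mulr1.
Qed.

Definition tpair P Q T (f : ahom P T) (g : ahom Q T) : ahom (tensor P Q) T :=
  pres_lift (tpair_subproof f g).

Lemma tpairE P Q T (f : ahom P T) (g : ahom Q T) x y :
  tpair f g (x ⊗ y) = f x * g y.
Proof. exact: pres_liftE. Qed.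

Definition tmap P Q S T (f : ahom P S) (g : ahom Q T) :
  ahom (tensor P Q) (tensor S T) := tpair (tinl S T \oa f) (tinr S T \oa g).

Lemma tmapE P Q S T (f : ahom P S) (g : ahom Q T) x y :
  tmap f g (x ⊗ y) = f x ⊗ g y.
Proof. by rewrite tpairE !ahomE tinlE tinrE -tens_split. Qed.

Definition tswap P Q : ahom (tensor P Q) (tensor Q P) :=
  tpair (tinr Q P) (tinl Q P).

Lemma tswapE P Q x y : tswap P Q (x ⊗ y) = y ⊗ x.
Proof. by rewrite tpairE tinlE tinrE mulrC -tens_split. Qed.

Definition tassoc P Q S :
  ahom (tensor (tensor P Q) S) (tensor P (tensor Q S)) :=
  tpair (tpair (tinl P (tensor Q S)) (tinr P (tensor Q S) \oa tinl Q S))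
        (tinr P (tensor Q S) \oa tinr Q S).

Lemma tassocE P Q S x y z : tassoc P Q S (x ⊗ y ⊗ z) = x ⊗ (y ⊗ z).
Proof.
by rewrite !(tpairE, ahomE, tinlE, tinrE) -!tensM !(mul1r, mulr1) -tens_split.
Qed.

Lemma comp_tpair P Q S T (h : ahom S T) (f : ahom P S) (g : ahom Q S) :
  h \oa tpair f g = tpair (h \oa f) (h \oa g).
Proof.
by apply: tensor_ext => x y; rewrite !(ahomE, tpairE) rmorphM.
Qed.

Lemma tpair_tmap P Q P' Q' T (f : ahom P' T) (g : ahom Q' T)
  (h : ahom P P') (k : ahom Q Q') :
  tpair f g \oa tmap h k = tpair (f \oa h) (g \oa k).
Proof.
by apply: tensor_ext => x y; rewrite !(ahomE, tmapE, tpairE).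
Qed.

Lemma tpair_tswap P Q T (f : ahom P T) (g : ahom Q T) :
  tpair g f \oa tswap P Q = tpair f g.
Proof.
by apply: tensor_ext => x y; rewrite ahomE tswapE !tpairE mulrC.
Qed.

Lemma tpair_tassoc P Q S T (f : ahom P T) (g : ahom Q T) (h : ahom S T) :
  tpair f (tpair g h) \oa tassoc P Q S = tpair (tpair f g) h.
Proof.
apply: tensor_ext => xy z; rewrite [RHS]tpairE.
have /ahomP/(_ xy) <- : tpair f (tpair g h) \oa tassoc P Q S \oa tinl _ S
  = tpair f g.
  apply: tensor_ext => x y.
  by rewrite !ahomE tinlE tassocE !tpairE rmorph1 mulr1.
rewrite !ahomE tinlE [in LHS]tens_split !rmorphM; congr (_ * _).
by rewrite -[in LHS](tens1 P Q) tassocE !tpairE !rmorph1 !mul1r.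
Qed.

End Tensor.
Arguments tensor : simpl never.

Notation "x ⊗ y" := (tens x y) (at level 38, left associativity) : ring_scope.

Definition tensE :=
  (ahomE, @tmapE, @tpairE, @tassocE, @tswapE, @tinlE, @tinrE).

(* The co-zero and the co-one are [colin 0] and [colin 1]. The additive
   antipode [coopp] is determined by the other data. *)
Record biring (A B : comPzRingType) (S : calg A) := Biring {
  coadd : ahom S (tensor S S);
  comul : ahom S (tensor S S);
  coopp : ahom S S;
  colin : B -> ahom S (calg_self A);
  coaddA : tassoc S S S \oa tmap coadd (ahom_id S) \oa coadd
           = tmap (ahom_id S) coadd \oa coadd;
  coaddC : tswap S S \oa coadd = coadd;
  coadd0 : tpair (ahom_unit S \oa colin 0) (ahom_id S) \oa coadd = ahom_id S;
  coaddN : tpair coopp (ahom_id S) \oa coadd = ahom_unit S \oa colin 0;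
  comulA : tassoc S S S \oa tmap comul (ahom_id S) \oa comul
           = tmap (ahom_id S) comul \oa comul;
  comulC : tswap S S \oa comul = comul;
  comul1 : tpair (ahom_unit S \oa colin 1) (ahom_id S) \oa comul = ahom_id S;
  comulDl : tmap coadd (ahom_id S) \oa comul
            = tpair (tmap (tinl S S) (ahom_id S) \oa comul)
                    (tmap (tinr S S) (ahom_id S) \oa comul) \oa coadd;
  colinD : forall b c, colin (b + c) = tpair (colin b) (colin c) \oa coadd;
  colinM : forall b c, colin (b * c) = tpair (colin b) (colin c) \oa comul }.

Definition is_biring_hom (A B : comPzRingType) (S T : calg A)
    (s : biring B S) (t : biring B T) (f : ahom S T) : Prop :=
  [/\ tmap f f \oa coadd s = coadd t \oa f,
      tmap f f \oa comul s = comul t \oa f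
    & forall b, colin t b \oa f = colin s b].

Section HomAlgebra.
Context {A B : comPzRingType} {S : calg A} (s : biring B S) (T : calg A).

Definition bhom_car : Type := ahom S T.
HB.instance Definition _ := gen_eqMixin bhom_car.
HB.instance Definition _ := gen_choiceMixin bhom_car.
Implicit Types f g h : bhom_car.

Definition bhom_cst (b : B) : bhom_car := ahom_unit T \oa colin s b.
Definition bhom_add f g : bhom_car := tpair f g \oa coadd s.
Definition bhom_opp f : bhom_car := f \oa coopp s.
Definition bhom_mul f g : bhom_car := tpair f g \oa comul s.

Let addA : associative bhom_add.
Proof.
move=> f g h; rewrite /bhom_add.
have := congr1 (ahom_comp (tpair f (tpair g h))) (coaddA s).
rewrite !ahom_compA tpair_tassoc !tpair_tmap !ahom_comp1r => <-.
by [].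
Qed.

Let addC : commutative bhom_add.
Proof.
by move=> f g; rewrite /bhom_add -{1}(coaddC s) ahom_compA tpair_tswap.
Qed.

Let add0 : left_id (bhom_cst 0) bhom_add.
Proof.
move=> f; rewrite -{2}(ahom_comp1r f) -(coadd0 s) ahom_compA comp_tpair.
by rewrite ahom_compA ahom_comp_unit ahom_comp1r.
Qed.

Let addN : left_inverse (bhom_cst 0) bhom_opp bhom_add.
Proof.
move=> f; rewrite /bhom_cst -(ahom_comp_unit f) -ahom_compA -(coaddN s).
by rewrite ahom_compA comp_tpair ahom_comp1r.
Qed.

HB.instance Definition _ := GRing.isZmodule.Build bhom_car addA addC add0 addN.

Let mulA : associative bhom_mul.
Proof.
move=> f g h; rewrite /bhom_mul.
have := congr1 (ahom_comp (tpair f (tpair g h))) (comulA s).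
rewrite !ahom_compA tpair_tassoc !tpair_tmap !ahom_comp1r => <-.
by [].
Qed.

Let mulC : commutative bhom_mul.
Proof.
by move=> f g; rewrite /bhom_mul -{1}(comulC s) ahom_compA tpair_tswap.
Qed.

Let mul1 : left_id (bhom_cst 1) bhom_mul.
Proof.
move=> f; rewrite -{2}(ahom_comp1r f) -(comul1 s) ahom_compA comp_tpair.
by rewrite ahom_compA ahom_comp_unit ahom_comp1r.
Qed.

Lemma tpair_tinl f g : tpair f g \oa tinl S S = f.
Proof.
by apply/ahomP => x; rewrite ahomE ?tinlE ?tinrE tpairE rmorph1 mulr1.
Qed.

Lemma tpair_tinr f g : tpair f g \oa tinr S S = g.
Proof.
by apply/ahomP => x; rewrite ahomE ?tinlE ?tinrE tpairE rmorph1 mul1r.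
Qed.

Let mulDl : left_distributive bhom_mul bhom_add.
Proof.
move=> f g h; rewrite /bhom_mul /bhom_add.
have := congr1 (ahom_comp (tpair (tpair f g) h)) (comulDl s).
rewrite !ahom_compA comp_tpair !ahom_compA !tpair_tmap !ahom_comp1r.
by rewrite tpair_tinl tpair_tinr.
Qed.

HB.instance Definition _ :=
  GRing.Zmodule_isComPzRing.Build bhom_car mulA mulC mul1 mulDl.

Lemma bhom_cstD b c : bhom_cst (b + c) = bhom_cst b + bhom_cst c.
Proof.
by rewrite [RHS]/(bhom_add _ _) /bhom_add /bhom_cst -comp_tpair -ahom_compA
  -colinD.
Qed.

Lemma bhom_cstM b c : bhom_cst (b * c) = bhom_cst b * bhom_cst c.
Proof.
by rewrite [RHS]/(bhom_mul _ _) /bhom_mul /bhom_cst -comp_tpair -ahom_compA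
  -colinM.
Qed.

Let cst_zmod : zmod_morphism bhom_cst.
Proof.
by move=> b c; apply: (addIr (bhom_cst c)); rewrite -bhom_cstD !subrK.
Qed.
Let cst_monoid : monoid_morphism bhom_cst.
Proof. by split=> // b c; exact: bhom_cstM. Qed.
HB.instance Definition _ :=
  GRing.isZmodMorphism.Build B bhom_car bhom_cst cst_zmod.
HB.instance Definition _ :=
  GRing.isMonoidMorphism.Build B bhom_car bhom_cst cst_monoid.

Definition bhom : calg B := @CAlg B (GRing.ComPzRing.clone bhom_car _) bhom_cst.

End HomAlgebra.

Section HomFunctoriality.
Context {A B : comPzRingType} {S : calg A} (s : biring B S) (T U : calg A).

Lemma bhom_map_subproof (f : ahom T U) :
  is_ahom (fun g : bhom s T => (f \oa g : bhom s U)).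
Proof.
split=> [g h|g h|b].
- exact: etrans (ahom_compA f (tpair g h) (coadd s))
                (congr1 (fun k => k \oa coadd s) (comp_tpair f g h)).
- exact: etrans (ahom_compA f (tpair g h) (comul s))
                (congr1 (fun k => k \oa comul s) (comp_tpair f g h)).
- exact: etrans (ahom_compA f (ahom_unit T) (colin s b))
                (congr1 (fun k => k \oa colin s b) (ahom_comp_unit f)).
Qed.

Definition bhom_map (f : ahom T U) : ahom (bhom s T) (bhom s U) :=
  build_ahom (bhom_map_subproof f).

End HomFunctoriality.

Section Odot.
Context {A B : comPzRingType} {S : calg A} (s : biring B S).

Definition odot_sum (R : calg B) (ps : seq (S * S)) (r r' : R) :
    term A (S * R) :=
  foldr (fun p t => Add (Mul (Gen (p.1, r)) (Gen (p.2, r'))) t) (Cst 0) ps.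

(* In [OdotCoadd] and [OdotComul], ps ranges over all the expressions of the
   coproduct of x as a finite sum of pure tensors (see [tensor_sumP]). *)
Inductive odot_rel (R : calg B) : term A (S * R) -> term A (S * R) -> Prop :=
| OdotD x y r :
    odot_rel (Gen (x + y, r)) (Add (Gen (x, r)) (Gen (y, r)))
| OdotM x y r :
    odot_rel (Gen (x * y, r)) (Mul (Gen (x, r)) (Gen (y, r)))
| OdotC a r : odot_rel (Gen (algmap S a, r)) (Cst a)
| OdotCoadd x ps r r' : coadd s x = \sum_(p <- ps) p.1 ⊗ p.2 ->
    odot_rel (Gen (x, r + r')) (odot_sum ps r r')
| OdotComul x ps r r' : comul s x = \sum_(p <- ps) p.1 ⊗ p.2 ->
    odot_rel (Gen (x, r * r')) (odot_sum ps r r')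
| OdotColin x b : odot_rel (Gen (x, algmap R b)) (Cst (colin s b x)).

Definition odot (R : calg B) : calg A := pres (@odot_rel R).
Definition odot_gen (R : calg B) (x : S) (r : R) : odot R :=
  pgen (@odot_rel R) (x, r).

Lemma odot_sum_map (R R' : calg B) (f : ahom R R') ps r r' :
  term_eval (fun p : S * R => odot_gen p.1 (f p.2)) (odot_sum ps r r') =
  term_eval (T := odot R') (pgen (@odot_rel R')) (odot_sum ps (f r) (f r')).
Proof. by elim: ps => //= p ps ->. Qed.

Lemma odot_map_subproof (R R' : calg B) (f : ahom R R') t u :
  odot_rel t u ->
  term_eval (fun p : S * R => odot_gen p.1 (f p.2)) t =
  term_eval (fun p : S * R => odot_gen p.1 (f p.2)) u.
Proof.
case=> [x y r|x y r|a r|x ps r r' e|x ps r r' e|x b];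
  rewrite ?odot_sum_map /= ?(rmorphD f) ?(rmorphM f) ?(ahomC f).
- exact: (pres_rel (OdotD x y (f r))).
- exact: (pres_rel (OdotM x y (f r))).
- exact: (pres_rel (OdotC a (f r))).
- exact: (pres_rel (OdotCoadd (f r) (f r') e)).
- exact: (pres_rel (OdotComul (f r) (f r') e)).
- exact: (pres_rel (OdotColin R' x b)).
Qed.

Definition odot_map (R R' : calg B) (f : ahom R R') : ahom (odot R) (odot R') :=
  pres_lift (odot_map_subproof f).

Lemma odot_mapE (R R' : calg B) (f : ahom R R') x r :
  odot_map f (odot_gen x r) = odot_gen x (f r).
Proof. exact: pres_liftE. Qed.

End Odot.

Record category := Category {
  ob :> Type;
  hom : ob -> ob -> Type;
  idm : forall x, hom x x;
  cmp : forall x y z, hom y z -> hom x y -> hom x z;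
  cmpA : forall x y z t (h : hom z t) (g : hom y z) (f : hom x y),
    cmp h (cmp g f) = cmp (cmp h g) f;
  cmp1l : forall x y (f : hom x y), cmp (idm y) f = f;
  cmp1r : forall x y (f : hom x y), cmp f (idm x) = f }.
Arguments hom {_} _ _.
Arguments idm {_} _.
Arguments cmp {_ _ _ _} _ _.

Record functor (C E : category) := Functor {
  fob :> C -> E;
  fhom : forall x y, hom x y -> hom (fob x) (fob y);
  fhom1 : forall x, fhom (idm x) = idm (fob x);
  fhomM : forall x y z (g : hom y z) (f : hom x y),
    fhom (cmp g f) = cmp (fhom g) (fhom f) }.
Arguments fhom {C E} _ {x y} _.

Definition adjoint (C E : category) (L : functor C E) (G : functor E C) :
    Prop :=
  exists phi : forall (x : C) (y : E), hom (L x) y -> hom x (G y),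
    (forall x y, bijective (@phi x y)) /\
    (forall x x' y y' (f : hom x' x) (g : hom y y') (u : hom (L x) y),
       phi x' y' (cmp g (cmp u (fhom L f)))
       = cmp (fhom G g) (cmp (phi x y u) f)).

Section FullSubcategory.
Variables (C : category) (P : C -> Prop).

Definition fullsub : category :=
  @Category {x : C | P x} (fun x y => hom (sval x) (sval y))
    (fun x => idm (sval x)) (fun x y z g f => cmp g f)
    (fun x y z t => @cmpA C (sval x) (sval y) (sval z) (sval t))
    (fun x y => @cmp1l C (sval x) (sval y))
    (fun x y => @cmp1r C (sval x) (sval y)).

Definition fullsub_incl : functor fullsub C :=
  @Functor fullsub C (fun x => sval x) (fun x y f => f)
    (fun=> erefl) (fun _ _ _ _ _ => erefl).

Definition corestrict (E : category) (F : functor E C)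
    (FP : forall x, P (F x)) : functor E fullsub :=
  @Functor E fullsub (fun x => exist P (F x) (FP x)) (fun x y f => fhom F f)
    (fhom1 F) (fhomM F).

(* F is corestricted to the subcategory before being compared with the
   inclusion, so these predicates also assert that F takes its values there. *)
Definition right_adjoint_of_incl (F : functor C C) : Prop :=
  exists FP : forall x, P (F x), adjoint fullsub_incl (corestrict FP).

Definition left_adjoint_of_incl (F : functor C C) : Prop :=
  exists FP : forall x, P (F x), adjoint (corestrict FP) fullsub_incl.

End FullSubcategory.

Definition calg_cat (R : comPzRingType) : category :=
  @Category (calg R) (@ahom R) ahom_id (@ahom_comp R)
    (fun x y z t h g f => ahom_compA h g f)
    (@ahom_comp1l R) (@ahom_comp1r R).

Section BiringFunctors.
Context {A B : comPzRingType} {S : calg A} (s : biring B S).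

Lemma bhom_map1 T : bhom_map s (ahom_id T) = ahom_id (bhom s T).
Proof. by apply/ahomP => f; exact: ahom_comp1l. Qed.

Lemma bhom_mapM T U V (g : ahom U V) (f : ahom T U) :
  bhom_map s (g \oa f) = bhom_map s g \oa bhom_map s f.
Proof. by apply/ahomP => h; apply: esym; exact: ahom_compA. Qed.

Definition bhom_functor : functor (calg_cat A) (calg_cat B) :=
  @Functor (calg_cat A) (calg_cat B) (bhom s) (@bhom_map A B S s)
    bhom_map1 bhom_mapM.

Lemma odot_map1 R : odot_map s (ahom_id R) = ahom_id (odot s R).
Proof. by apply: pres_ext => -[x r]; exact: odot_mapE. Qed.

Lemma odot_mapM R R' R'' (g : ahom R' R'') (f : ahom R R') :
  odot_map s (g \oa f) = odot_map s g \oa odot_map s f.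
Proof.
apply: pres_ext => -[x r]; rewrite ahom_compE -/(odot_gen s x r).
by rewrite !odot_mapE.
Qed.

Definition odot_functor : functor (calg_cat B) (calg_cat A) :=
  @Functor (calg_cat B) (calg_cat A) (odot s) (@odot_map A B S s)
    odot_map1 odot_mapM.

End BiringFunctors.

Section PolyBiring.
Variable R : comNzRingType.
Implicit Types T : calg R.

Definition poly_calg : calg R :=
  @CAlg R (GRing.ComPzRing.clone {poly R} _) (@polyC R).

(* The library evaluates polynomials only in nonzero rings. *)
Definition poly_eval_fun T (t : T) (p : poly_calg) : T :=
  \sum_(i < size (p : {poly R})) algmap T (p : {poly R})`_i * t ^+ i.

Lemma poly_eval_widen T (t : T) (p : {poly R}) n : (size p <= n)%N ->
  poly_eval_fun t p = \sum_(i < n) algmap T p`_i * t ^+ i.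
Proof.
move=> pn; rewrite /poly_eval_fun.
rewrite (big_ord_widen n (fun i => algmap T p`_i * t ^+ i) pn) big_mkcond /=.
apply: eq_bigr => i _; case: ltnP => // /(nth_default 0) ->.
by rewrite rmorph0 mul0r.
Qed.

Lemma poly_evalD T (t : T) : {morph poly_eval_fun t : p q / p + q}.
Proof.
move=> p q; pose n := maxn (size (p : {poly R})) (size (q : {poly R})).
have np : (size (p : {poly R}) <= n)%N by rewrite leq_maxl.
have nq : (size (q : {poly R}) <= n)%N by rewrite leq_maxr.
rewrite (poly_eval_widen t np) (poly_eval_widen t nq).
rewrite (@poly_eval_widen _ t (p + q) n (size_polyD _ _)) -big_split /=.
by apply: eq_bigr => i _; rewrite coefD rmorphD mulrDl.
Qed.

Lemma poly_evalC T (t : T) (c : R) : poly_eval_fun t c%:P = algmap T c.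
Proof.
by rewrite (poly_eval_widen t (size_polyC_leq1 c)) big_ord1 coefC mulr1.
Qed.

Lemma poly_evalMX T (t : T) (p : {poly R}) :
  poly_eval_fun t (p * 'X) = poly_eval_fun t p * t.
Proof.
have sz : (size (p * 'X)%R <= (size p).+1)%N.
  by rewrite (leq_trans (size_polyMleq _ _)) // size_polyX addn2.
rewrite (poly_eval_widen t sz) big_ord_recl coefMX /= rmorph0 mul0r add0r.
rewrite mulr_suml; apply: eq_bigr => i _.
by rewrite coefMX /= exprSr mulrA.
Qed.

Lemma poly_evalCM T (t : T) (c : R) (p : {poly R}) :
  poly_eval_fun t (c%:P * p) = algmap T c * poly_eval_fun t p.
Proof.
have sz : (size (c%:P * p)%R <= size p)%N.
  by rewrite mul_polyC size_scale_leq.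
rewrite (poly_eval_widen t sz) mulr_sumr; apply: eq_bigr => i _.
by rewrite coefCM rmorphM mulrA.
Qed.

Lemma poly_evalM T (t : T) : {morph poly_eval_fun t : p q / p * q}.
Proof.
move=> p q; elim/poly_ind: p => [|p c IH].
  have e0 : poly_eval_fun t 0 = 0 by rewrite -[0]/(0%:P) poly_evalC rmorph0.
  by rewrite mul0r e0 mul0r.
rewrite mulrDl -mulrA ['X * _]mulrC mulrA !poly_evalD poly_evalCM.
by rewrite !poly_evalMX poly_evalC IH mulrDl mulrAC.
Qed.

Lemma poly_eval_subproof T (t : T) : is_ahom (poly_eval_fun t).
Proof.
by split=> [p q|p q|c]; [exact: poly_evalD | exact: poly_evalM |
  exact: poly_evalC].
Qed.

Definition poly_eval T (t : T) : ahom poly_calg T :=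
  build_ahom (poly_eval_subproof t).

Definition poly_X : poly_calg := ('X : {poly R}).

Lemma poly_evalX T (t : T) : poly_eval t poly_X = t.
Proof.
rewrite /= /poly_X -['X]mul1r (poly_evalMX t 1) -[1]/(1%:P) poly_evalC.
by rewrite rmorph1 mul1r.
Qed.

Lemma poly_ext T (f g : ahom poly_calg T) : f poly_X = g poly_X -> f = g.
Proof.
move=> fg; apply/ahomP; elim/poly_ind => [|p c IH]; first by rewrite !rmorph0.
rewrite (rmorphD f) (rmorphD g) (rmorphM f) (rmorphM g) IH.
by rewrite -!/poly_X fg (ahomC f c) (ahomC g c).
Qed.

Definition poly_coadd : ahom poly_calg (tensor poly_calg poly_calg) :=
  poly_eval (poly_X ⊗ 1 + 1 ⊗ poly_X).
Definition poly_comul : ahom poly_calg (tensor poly_calg poly_calg) :=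
  poly_eval (poly_X ⊗ poly_X).
Definition poly_coopp : ahom poly_calg poly_calg := poly_eval (- poly_X).
Definition poly_colin (a : R) : ahom poly_calg (calg_self R) :=
  poly_eval (a : calg_self R).

Lemma poly_colinE a (f : {poly R}) : poly_colin a f = f.[a].
Proof. by rewrite horner_coef. Qed.

Lemma poly_coaddX : poly_coadd poly_X = poly_X ⊗ 1 + 1 ⊗ poly_X.
Proof. exact: poly_evalX. Qed.
Lemma poly_comulX : poly_comul poly_X = poly_X ⊗ poly_X.
Proof. exact: poly_evalX. Qed.
Lemma poly_cooppX : poly_coopp poly_X = - poly_X.
Proof. exact: poly_evalX. Qed.
Lemma poly_colinX a : poly_colin a poly_X = a.
Proof. exact: poly_evalX. Qed.

Let cE := (poly_coaddX, poly_comulX, poly_cooppX, poly_colinX, tensE).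
Local Notation P := poly_calg.

Let coaddA : tassoc P P P \oa tmap poly_coadd (ahom_id P) \oa poly_coadd
  = tmap (ahom_id P) poly_coadd \oa poly_coadd.
Proof.
apply: poly_ext; rewrite !cE !ahomD !tmapE !poly_coaddX !ahom_idE !ahom1.
by rewrite tensDl tensDr ahomD -(tens1 P P) !tassocE addrA tens1.
Qed.

Let coaddC : tswap P P \oa poly_coadd = poly_coadd.
Proof. by apply: poly_ext; rewrite !cE ahomD !cE addrC. Qed.

Let coadd0 : tpair (ahom_unit P \oa poly_colin 0) (ahom_id P) \oa poly_coadd
  = ahom_id P.
Proof.
apply: poly_ext; rewrite !cE ahomD !cE !ahom1 rmorph0.
by rewrite mul0r add0r mul1r.
Qed.

Let coaddN : tpair poly_coopp (ahom_id P) \oa poly_coadd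
  = ahom_unit P \oa poly_colin 0.
Proof.
apply: poly_ext; rewrite !cE ahomD !cE !ahom1 rmorph0.
by rewrite mulr1 mul1r addNr.
Qed.

Let comulA : tassoc P P P \oa tmap poly_comul (ahom_id P) \oa poly_comul
  = tmap (ahom_id P) poly_comul \oa poly_comul.
Proof. by apply: poly_ext; rewrite !cE. Qed.

Let comulC : tswap P P \oa poly_comul = poly_comul.
Proof. by apply: poly_ext; rewrite !cE. Qed.

Let comul1 : tpair (ahom_unit P \oa poly_colin 1) (ahom_id P) \oa poly_comul
  = ahom_id P.
Proof. by apply: poly_ext; rewrite !cE rmorph1 mul1r. Qed.

Let comulDl : tmap poly_coadd (ahom_id P) \oa poly_comul
  = tpair (tmap (tinl P P) (ahom_id P) \oa poly_comul)
          (tmap (tinr P P) (ahom_id P) \oa poly_comul) \oa poly_coadd.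
Proof.
apply: poly_ext; rewrite !cE ahomD !cE !ahom1 mulr1 mul1r.
by rewrite tensDl.
Qed.

Let colinD b c : poly_colin (b + c)
  = tpair (poly_colin b) (poly_colin c) \oa poly_coadd.
Proof.
by apply: poly_ext; rewrite !cE ahomD !cE !ahom1 mulr1 mul1r.
Qed.

Let colinM b c : poly_colin (b * c)
  = tpair (poly_colin b) (poly_colin c) \oa poly_comul.
Proof. by apply: poly_ext; rewrite !cE. Qed.

Definition poly_biring : biring R poly_calg :=
  Biring coaddA coaddC coadd0 coaddN comulA comulC comul1 comulDl
    colinD colinM.

End PolyBiring.

Section IntD.
Variable D : idomainType.
Local Notation K := {fraction D}.
Local Notation "x %:F" := (@FracField.tofrac D x) (at level 1, format "x %:F").

Definition int_valued : {pred {poly K}} :=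
  fun f => `[< forall d : D, exists e : D, f.[d%:F] = e%:F >].

Lemma int_valuedP (f : {poly K}) :
  reflect (forall d : D, exists e : D, f.[d%:F] = e%:F) (f \in int_valued).
Proof. exact: asboolP. Qed.

Fact int_valued_subring : subring_closed int_valued.
Proof.
split=> [|f g /int_valuedP fD /int_valuedP gD
         |f g /int_valuedP fD /int_valuedP gD];
  apply/int_valuedP => d.
- by exists 1; rewrite hornerC tofrac1.
- have [a fa] := fD d; have [b gb] := gD d; exists (a - b).
  by rewrite hornerD hornerN fa gb tofracB.
- have [a fa] := fD d; have [b gb] := gD d; exists (a * b).
  by rewrite hornerM fa gb tofracM.
Qed.

Record intpoly :=
  IntPoly { intpoly_val :> {poly K}; _ : intpoly_val \in int_valued }.
HB.instance Definition _ := [isSub for intpoly_val].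
HB.instance Definition _ := [Choice of intpoly by <:].
HB.instance Definition _ :=
  GRing.SubChoice_isSubComNzRing.Build _ _ intpoly int_valued_subring.

Lemma map_tofrac_int (p : {poly D}) :
  map_poly (@FracField.tofrac D) p \in int_valued.
Proof.
by apply/int_valuedP => d; exists p.[d]; rewrite horner_map.
Qed.

Definition intpoly_of (p : {poly D}) : intpoly := IntPoly (map_tofrac_int p).

Fact intpoly_of_zmod : zmod_morphism intpoly_of.
Proof. by move=> p q; apply: val_inj; rewrite /= rmorphB. Qed.
Fact intpoly_of_monoid : monoid_morphism intpoly_of.
Proof.
by split=> [|p q]; apply: val_inj; rewrite /= ?rmorph1 ?rmorphM.
Qed.
HB.instance Definition _ :=
  GRing.isZmodMorphism.Build {poly D} intpoly intpoly_of intpoly_of_zmod.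
HB.instance Definition _ :=
  GRing.isMonoidMorphism.Build {poly D} intpoly intpoly_of intpoly_of_monoid.

Definition Int : calg D :=
  @CAlg D (GRing.ComPzRing.clone intpoly _) (intpoly_of \o polyC).

Definition Int_incl : ahom (poly_calg D) Int :=
  @AHom D (poly_calg D) Int intpoly_of (fun=> erefl).

Definition IntX : Int := Int_incl (poly_X D).

Definition compatible (s : biring D Int) : Prop :=
  is_biring_hom (poly_biring D) s Int_incl.

Definition torsion_free (A : calg D) : Prop :=
  forall (d : D) (a : A), d != 0 -> algmap A d * a = 0 -> a = 0.

Definition wpc (A : calg D) : Prop :=
  forall a : A, exists phi : ahom Int A, phi IntX = a.

Definition tf_wpc (A : calg_cat D) : Prop := torsion_free A /\ wpc A.

(* The library's [idealr] are the proper ideals; the unit ideal is always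
   principal. *)
Definition is_pid : Prop :=
  forall I : idealr D, exists a : D, forall x, x \in I <-> exists y, x = a * y.

Definition maximal_ideal (m : idealr D) : Prop :=
  forall J : idealr D, {subset m <= J} -> {subset J <= m}.

Definition finite_residue_fields : Prop :=
  forall m : idealr D, maximal_ideal m -> finite_set [set: {ideal_quot m}].

Definition adjoints_of_inclusion (s : biring D Int) : Prop :=
  right_adjoint_of_incl tf_wpc (bhom_functor s) /\
  left_adjoint_of_incl tf_wpc (odot_functor s).

Definition values_torsion_free (s : biring D Int) : Prop :=
  forall A : calg D, torsion_free (bhom s A) /\ torsion_free (odot s A).

End IntD.

(* Main.v *)
(* A homomorphism from Int(D) to a torsion-free algebra is determined by the
   image of X. So for W torsion-free and WPC, evaluation at X identifies
   Hom(Int(D), W) with W; its inverse [sharp] is the unit of one adjunction and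
   induces the other. Applied to W = Int(D), it gives an action of Int(D) on
   Hom(Int(D), A) for every A (on F, G it is composition of polynomials), and
   hence weak polynomial completeness of all the values of both functors.

   For the torsion of Hom(Int(D), A) over a PID, an annihilator reduces to the
   case p h = 0 with p prime. With r ranging over representatives of the nonzero
   classes mod p, g = X * prod (X - r) / p is integer-valued and
   g(p X) = X * prod (p X - r), so that 0 = g(p h) = h * prod (- r), whence
   h = 0. Moreover Int(D) (.) A embeds into Hom(Int(D), Int(D) (.) A).

   For the existence of the biring structure, Int(D) has a basis with one
   element of each degree, so Int(D) (x) Q is torsion-free if Q is, and an
   element of Int(D) (x) Int(D) is divisible by d as soon as all its values are.
   Hence Int(D) (x) Int(D) is WPC, which provides the coproducts; the biring
   laws need only be checked at X. (If D is a field, every D-algebra is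
   torsion-free and WPC.) *)
From HB Require Import structures.
Require Import Defs.
From mathcomp Require Import all_boot all_algebra.
From mathcomp Require Import boolp classical_sets cardinality.

Set Implicit Arguments.
Unset Strict Implicit.
Unset Printing Implicit Defensive.

Import GRing.Theory.
Local Open Scope ring_scope.

Notation "x %:F" := (@FracField.tofrac _ x) (at level 1, format "x %:F").

(** * Denominators, evaluation and weak polynomial completeness of Int(D) *)

Section IntegerValued.
Variable D : idomainType.
Implicit Types (T W : calg D) (F G : Int D) (p : {poly D}) (c d e : D).
Local Notation K := {fraction D}.
Local Notation tofrac := (@FracField.tofrac D).

Lemma tofrac_inj : injective tofrac.
Proof. by move=> x y /eqP; rewrite tofrac_eq => /eqP. Qed.

Lemma frac_denom (x : K) : exists d n : D, d != 0 /\ d%:F * x = n%:F.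
Proof.
rewrite -[x]reprK; move: (repr x) => r; exists (\d_r), (\n_r).
split; first exact: denom_ratioP.
unlock FracField.tofrac; rewrite -[LHS]FracField.pi_mul.
apply/eqP; rewrite FracField.equivf_def /FracField.mulf /FracField.equivf /=.
by rewrite !numden_Ratio ?oner_neq0 ?mul1r ?mulr1 ?denom_ratioP // mulrC.
Qed.

Lemma poly_denom (f : {poly K}) :
  exists d p, d != 0 /\ d%:F *: f = map_poly tofrac p.
Proof.
elim/poly_ind: f => [|f x [d [p [d0 dp]]]].
  by exists 1, 0; rewrite oner_neq0 scaler0 rmorph0.
have [e [n [e0 en]]] := frac_denom x.
exists (e * d), (e *: p * 'X + (d * n)%:P); split; first by rewrite mulf_neq0.
apply/polyP => i; have := congr1 (fun q : {poly K} => q`_i.-1) dp.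
rewrite !(coefZ, coef_map, coefD, coefMX, coefC) /=.
case: i => [|i] /= dpi; last by rewrite !addr0 !tofracM -mulrA dpi.
by rewrite !add0r !tofracM -en mulrCA mulrA.
Qed.

Lemma Int_algmapE d F :
  intpoly_val (algmap (Int D) d * F) = d%:F *: intpoly_val F.
Proof. by rewrite [LHS]/= map_polyC mul_polyC. Qed.

Lemma Int_inclE p : intpoly_val (Int_incl D p) = map_poly tofrac p.
Proof. by []. Qed.

Lemma Int_denom F :
  exists d p, d != 0 /\ algmap (Int D) d * F = Int_incl D p.
Proof.
have [d [p [d0 dp]]] := poly_denom (intpoly_val F).
by exists d, p; split=> //; apply: val_inj; rewrite [LHS]Int_algmapE dp.
Qed.

Lemma Int_tf : torsion_free (Int D).
Proof.
move=> d F d0 dF; apply: val_inj; have := congr1 (@intpoly_val D) dF.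
rewrite Int_algmapE => /eqP; rewrite scaler_eq0 tofrac_eq0 (negPf d0) /=.
by move/eqP.
Qed.

Lemma tf_inj T d : torsion_free T -> d != 0 -> injective ( *%R (algmap T d)).
Proof.
move=> tfT d0 x y xy; apply/eqP; rewrite -subr_eq0; apply/eqP.
by apply: (tfT d) => //; rewrite mulrBr xy subrr.
Qed.

(** Some nonzero multiple [d * F] lies in D[X], where [f] and [g] agree, and [d] cancels in [T]. *)
Lemma Int_ext T (f g : ahom (Int D) T) :
  torsion_free T -> f (IntX D) = g (IntX D) -> f = g.
Proof.
move=> tfT fg; apply/ahomP => F; have [d [p [d0 dp]]] := Int_denom F.
apply: (tf_inj tfT d0); rewrite /= -{1}(ahomC f) -(ahomC g) -!ahomM dp.
by have /ahomP/(_ p) : f \oa Int_incl D = g \oa Int_incl D by exact: poly_ext.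
Qed.

Lemma Int_agree T (f g : ahom (Int D) T) F :
  torsion_free T -> f (IntX D) = g (IntX D) -> f F = g F.
Proof. by move=> tfT fg; rewrite (Int_ext tfT fg). Qed.

Lemma poly_eval_hom T U (f : ahom T U) (t : T) p :
  f (poly_eval t p) = poly_eval (f t) p.
Proof.
have /ahomP/(_ p) // : f \oa poly_eval t = poly_eval (f t).
by apply: poly_ext; rewrite ahomE !poly_evalX.
Qed.

Lemma Int_inclX p : Int_incl D p = poly_eval (IntX D) p.
Proof.
by have /ahomP/(_ p) : Int_incl D = poly_eval (IntX D)
  by apply: poly_ext; rewrite poly_evalX.
Qed.

Lemma poly_eval_self c p : poly_eval (c : calg_self D) p = p.[c].
Proof. exact: poly_colinE. Qed.

(* For T torsion-free: F(t) exists in T for all F in Int(D) and t in T. *)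
Definition dvd_closed T : Prop := forall (t : T) d p, d != 0 ->
  (forall c, exists e, p.[c] = d * e) ->
  exists y : T, algmap T d * y = poly_eval t p.

Lemma Int_dvd_val d p F c : algmap (Int D) d * F = Int_incl D p ->
  exists e, p.[c] = d * e.
Proof.
move=> /(congr1 (fun f : Int D => (intpoly_val f).[c%:F])).
rewrite Int_algmapE Int_inclE horner_map hornerZ.
case: F => f fI /=; have [e ->] := int_valuedP _ fI c.
by rewrite -tofracM => /tofrac_inj <-; exists e.
Qed.

(** If [d * F = p] with [p] in D[X], then F(t) has to be the solution [y] of [d * y = p(t)], which
    is unique since [T] is torsion-free. *)
Lemma dvd_closed_wpc T : torsion_free T -> dvd_closed T -> wpc T.
Proof.
move=> tfT dT t.
(* A single [y] serves all denominators of [F], so sums and products below may use whichever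
   denominator is convenient. *)
have ex F : exists y : T, forall d p, d != 0 ->
    algmap (Int D) d * F = Int_incl D p -> algmap T d * y = poly_eval t p.
  have [d [p [d0 dp]]] := Int_denom F.
  have [|y dy] := dT t d p d0; first by move=> c; exact: Int_dvd_val dp.
  exists y => e q e0 eq; apply: (tf_inj tfT d0).
  rewrite /= mulrCA dy -!(ahomC (poly_eval t)) -!ahomM; congr (poly_eval _ _).
  have inj : injective (Int_incl D).
    move=> u v /(congr1 (@intpoly_val D)); rewrite !Int_inclE.
    exact: (map_inj_poly tofrac_inj (rmorph0 _)).
  by apply: inj; rewrite !ahomM !(ahomC (Int_incl D)) -dp -eq mulrCA.
have [f fP] := choice ex.
have fE F y d p : d != 0 -> algmap (Int D) d * F = Int_incl D p ->
    algmap T d * y = poly_eval t p -> f F = y.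
  by move=> d0 dF dy; apply: (tf_inj tfT d0); rewrite /= dy; exact: fP.
have fhom : is_ahom f.
  split=> [F G|F G|c].
  - have [d [p [d0 dp]]] := Int_denom F; have [e [q [e0 eq]]] := Int_denom G.
    apply: (fE _ _ (d * e) (e%:P * p + d%:P * q)); first by rewrite mulf_neq0.
      rewrite ahomD !ahomM !(ahomC (Int_incl D)) -dp -eq rmorphM mulrDr.
      by rewrite !mulrA; congr (_ * _ + _); rewrite mulrC.
    rewrite ahomD !ahomM !(ahomC (poly_eval t)) -(fP _ _ _ d0 dp).
    rewrite -(fP _ _ _ e0 eq) rmorphM mulrDr !mulrA.
    by congr (_ * _ + _); rewrite mulrC.
  - have [d [p [d0 dp]]] := Int_denom F; have [e [q [e0 eq]]] := Int_denom G.
    apply: (fE _ _ (d * e) (p * q)); first by rewrite mulf_neq0.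
      by rewrite ahomM -dp -eq rmorphM mulrACA.
    by rewrite ahomM -(fP _ _ _ d0 dp) -(fP _ _ _ e0 eq) rmorphM mulrACA.
  - apply: (fE _ _ 1 c%:P); first exact: oner_neq0.
      by rewrite rmorph1 mul1r.
    by rewrite rmorph1 mul1r (ahomC (poly_eval t)).
exists (build_ahom fhom); rewrite build_ahomE.
apply: (fE _ _ 1 'X); first exact: oner_neq0.
  by rewrite rmorph1 mul1r.
by rewrite rmorph1 mul1r poly_evalX.
Qed.

Lemma Int_dvd d F : d != 0 ->
  (forall c, exists e, (intpoly_val F).[c%:F] = (d * e)%:F) ->
  exists G, algmap (Int D) d * G = F.
Proof.
move=> d0 dF; have GI : (d%:F)^-1 *: intpoly_val F \in @int_valued D.
  apply/int_valuedP => c; have [e ce] := dF c; exists e.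
  by rewrite hornerZ ce tofracM mulKf // tofrac_eq0.
exists (IntPoly GI); apply: val_inj.
by rewrite [LHS]Int_algmapE /= scalerA divff ?scale1r // tofrac_eq0.
Qed.

Lemma self_tf : torsion_free (calg_self D).
Proof. by move=> d a d0 /eqP; rewrite mulf_eq0 (negPf d0) => /eqP. Qed.

Lemma self_wpc : wpc (calg_self D).
Proof.
apply: (dvd_closed_wpc self_tf) => c d p _ /(_ c)[e ce].
by exists e; rewrite poly_eval_self ce.
Qed.

(** Evaluation in K[X] has its values in the fraction field; this one lands in D, and [Int_evE]
    identifies the two. *)
Definition Int_ev c : ahom (Int D) (calg_self D) := projT1 (cid (self_wpc c)).

Lemma Int_evX c : Int_ev c (IntX D) = c.
Proof. by rewrite /Int_ev; case: cid. Qed.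

Lemma Int_evE c F : (intpoly_val F).[c%:F] = (Int_ev c F)%:F.
Proof.
have [d [p [d0 dp]]] := Int_denom F.
apply: (mulfI (x := d%:F)); first by rewrite tofrac_eq0.
rewrite -hornerZ -Int_algmapE dp Int_inclE horner_map -tofracM /=.
congr (_%:F); have := congr1 (Int_ev c) dp.
rewrite ahomM (ahomC (Int_ev c)) Int_inclX poly_eval_hom Int_evX.
by rewrite poly_eval_self.
Qed.

(** Divisibility by [d] in Int(D) is tested on values, and the value of p(t) at c is p(t(c)) with
    t(c) in D. *)
Lemma Int_wpc : wpc (Int D).
Proof.
apply: (dvd_closed_wpc Int_tf) => t d p d0 dp.
apply: Int_dvd => // c; have [e ce] := dp (Int_ev c t); exists e.
by rewrite Int_evE poly_eval_hom poly_eval_self ce.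
Qed.

Lemma Int_tf_wpc : tf_wpc (Int D).
Proof. by split; [exact: Int_tf | exact: Int_wpc]. Qed.

End IntegerValued.

(** * Adjunctions for a compatible biring structure *)

Section Compatible.
Variables (D : idomainType) (s : biring D (Int D)).
Hypothesis s_compat : compatible s.
Implicit Types (T U W A : calg D) (d e : D).
Local Notation X := (IntX D).

Lemma coaddX : coadd s X = X ⊗ 1 + 1 ⊗ X.
Proof.
case: s_compat => /ahomP/(_ (poly_X D)); rewrite !ahomE poly_coaddX => <- _ _.
by rewrite ahomD !tmapE !ahom1.
Qed.

Lemma comulX : comul s X = X ⊗ X.
Proof.
case: s_compat => _ /ahomP/(_ (poly_X D)); rewrite !ahomE poly_comulX => <- _.
by rewrite tmapE.
Qed.

Lemma colinX d : colin s d X = d.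
Proof.
by case: s_compat => _ _ /(_ d)/ahomP/(_ (poly_X D)); rewrite poly_colinX.
Qed.

(** By compatibility the structure maps are given at X by the formulas of D[X], so evaluation at X
    is the restriction from Hom(Int(D), T) to Hom(D[X], T) = T. *)
Lemma evX_subproof T : is_ahom (fun h : bhom s T => (h : ahom (Int D) T) X).
Proof.
split=> [h k|h k|d].
- rewrite [h + k]/(tpair (h : ahom _ _) k \oa coadd s) ahomE coaddX ahomD.
  by rewrite !tpairE !ahom1 mulr1 mul1r.
- rewrite [h * k]/(tpair (h : ahom _ _) k \oa comul s) ahomE comulX.
  by rewrite tpairE.
- by rewrite [algmap _ d]/(ahom_unit T \oa colin s d) ahomE colinX.
Qed.

Definition evX T : ahom (bhom s T) T := build_ahom (evX_subproof T).

Lemma evXE T (h : bhom s T) : evX T h = (h : ahom (Int D) T) X.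
Proof. by []. Qed.

Lemma evX_inj T : torsion_free T -> injective (evX T).
Proof. by move=> tfT h k hk; exact: Int_ext. Qed.

Lemma bhom_mapE T U (f : ahom T U) (h : bhom s T) F :
  (bhom_map s f h : ahom (Int D) U) F = f ((h : ahom (Int D) T) F).
Proof. by []. Qed.

Section Sharp.
Variables (W : calg D) (tW : tf_wpc W).
Let tfW : torsion_free W := proj1 tW.
Let wW : wpc W := proj2 tW.

Definition sharp_fun (w : W) : bhom s W := projT1 (cid (wW w)).

Lemma sharp_funX w : evX W (sharp_fun w) = w.
Proof. by rewrite /sharp_fun; case: cid. Qed.

Lemma sharp_subproof : is_ahom sharp_fun.
Proof.
split=> [v w|v w|d]; apply: (evX_inj tfW).
- by rewrite ahomD !sharp_funX.
- by rewrite ahomM !sharp_funX.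
- by rewrite (ahomC (evX W)) sharp_funX.
Qed.

Definition sharp : ahom W (bhom s W) := build_ahom sharp_subproof.

Lemma sharpX w : (sharp w : ahom (Int D) W) X = w.
Proof. exact: sharp_funX. Qed.

End Sharp.

(** Naturality of [sharp]: in [F], both sides are homomorphisms sending X to [f w]. *)
Lemma sharp_comp W W' (tW : tf_wpc W) (tW' : tf_wpc W') (f : ahom W' W) w F :
  f ((sharp tW' w : ahom (Int D) W') F) =
  (sharp tW (f w) : ahom (Int D) W) F.
Proof.
apply: (@Int_agree _ _ (f \oa (sharp tW' w : ahom (Int D) W'))).
  exact: (proj1 tW).
by rewrite ahomE !sharpX.
Qed.

Local Notation sharpI := (sharp (Int_tf_wpc D)).

(* F acts on h as G |-> h (G o F). *)
Definition Int_act A (h : bhom s A) : ahom (Int D) (bhom s A) :=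
  bhom_map s (h : ahom (Int D) A) \oa sharpI.

Lemma Int_actE A (h : bhom s A) F G :
  (Int_act h F : ahom (Int D) A) G =
  (h : ahom (Int D) A) ((sharpI F : ahom (Int D) (Int D)) G).
Proof. by []. Qed.

(** Take G = X in G o F. Thus every value of [h] is the value at X of another element of Hom(Int(D),
    A). *)
Lemma Int_act_evX A (h : bhom s A) F : evX A (Int_act h F) = (h : ahom _ A) F.
Proof. by rewrite evXE Int_actE sharpX. Qed.

Lemma sharpI_X : sharpI X = ahom_id (Int D).
Proof. by apply: Int_ext; [exact: Int_tf | exact: sharpX]. Qed.

Lemma Int_actX A (h : bhom s A) : Int_act h X = h.
Proof. by apply/ahomP => G; rewrite Int_actE sharpI_X. Qed.

Lemma bhom_wpc A : wpc (bhom s A).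
Proof. by move=> h; exists (Int_act h); exact: Int_actX. Qed.

Lemma odot_unit_subproof A :
  forall a : A, is_ahom (fun x : Int D => odot_gen s x a).
Proof.
move=> a; split=> [x y|x y|d].
- exact: (pres_rel (OdotD s x y a)).
- exact: (pres_rel (OdotM s x y a)).
- exact: (pres_rel (OdotC s d a)).
Qed.

(** The map x |-> x (.) a is the unit, at [a], of the adjunction between Int(D) (.) - and
    Hom(Int(D), -). *)
Definition odot_unit_fun A (a : A) : bhom s (odot s A) :=
  build_ahom (odot_unit_subproof a).

(** When [ps] expresses a coproduct of x, the right side is the value at x of the sum or product of
    [f] and [g] in Hom(Int(D), T). *)
Lemma odot_sumE A T (v : Int D * A -> T) (f g : ahom (Int D) T)
    (ps : seq (Int D * Int D)) (a b : A) :
  (forall x, v (x, a) = f x) -> (forall x, v (x, b) = g x) ->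
  term_eval v (odot_sum ps a b) = tpair f g (\sum_(p <- ps) p.1 ⊗ p.2).
Proof.
move=> va vb.
elim: ps => [|p ps IH]; first by rewrite big_nil ahom0; exact: rmorph0.
by rewrite big_cons ahomD tpairE -IH -va -vb.
Qed.

Lemma odot_unit_is_ahom A : is_ahom (@odot_unit_fun A).
Proof.
split=> [a b|a b|d]; apply/ahomP => x.
- have [ps e] := tensor_sumP (coadd s x).
  rewrite [LHS](pres_rel (OdotCoadd a b e)).
  rewrite (odot_sumE (f := odot_unit_fun a) (g := odot_unit_fun b)) //.
  by rewrite -e.
- have [ps e] := tensor_sumP (comul s x).
  rewrite [LHS](pres_rel (OdotComul a b e)).
  rewrite (odot_sumE (f := odot_unit_fun a) (g := odot_unit_fun b)) //.
  by rewrite -e.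
- exact: (pres_rel (OdotColin s A x d)).
Qed.

Definition odot_unit A : ahom A (bhom s (odot s A)) :=
  build_ahom (odot_unit_is_ahom A).

Lemma odot_unitE A (a : A) x :
  (odot_unit A a : ahom (Int D) (odot s A)) x = odot_gen s x a.
Proof. by []. Qed.

Lemma odot_lift_subproof A T (k : ahom A (bhom s T)) t u : odot_rel s t u ->
  term_eval (fun p : Int D * A => (k p.2 : ahom (Int D) T) p.1) t =
  term_eval (fun p : Int D * A => (k p.2 : ahom (Int D) T) p.1) u.
Proof.
case=> [x y r|x y r|a r|x ps r r' e|x ps r r' e|x b].
- exact: ahomD.
- exact: ahomM.
- exact: ahomC.
- by rewrite (odot_sumE (f := k r) (g := k r')) //= ahomD -e.
- by rewrite (odot_sumE (f := k r) (g := k r')) //= ahomM -e.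
- by rewrite /= (ahomC k).
Qed.

(** The transpose of [k] under the adjunction between Int(D) (.) - and Hom(Int(D), -). *)
Definition odot_lift A T (k : ahom A (bhom s T)) : ahom (odot s A) T :=
  pres_lift (odot_lift_subproof k).

Lemma odot_liftE A T (k : ahom A (bhom s T)) x a :
  odot_lift k (odot_gen s x a) = (k a : ahom (Int D) T) x.
Proof. exact: pres_liftE. Qed.

Lemma odot_ext A T (f g : ahom (odot s A) T) :
  (forall x a, f (odot_gen s x a) = g (odot_gen s x a)) -> f = g.
Proof. by move=> fg; apply: pres_ext => -[x a]; exact: fg. Qed.

(** It suffices that [evX] be onto [odot s A]. Its image is a subalgebra and contains x (.) a, the
    value at X of x acting on the unit at a. *)
Lemma odot_wpc A : wpc (odot s A).
Proof.
move=> z; suff [h hz] : exists h, evX (odot s A) h = z by exists h.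
rewrite -(pres_reprK z) -term_eval_pgen.
elim: (pres_repr z) => [[x a]|d|t [h ht] u [k ku]|t [h ht]|
  t [h ht] u [k ku]].
- by exists (Int_act (odot_unit A a) x); rewrite Int_act_evX.
- by exists (algmap _ d); rewrite (ahomC (evX _)).
- by exists (h + k); rewrite ahomD ht ku.
- by exists (- h); rewrite ahomN ht.
- by exists (h * k); rewrite ahomM ht ku.
Qed.

Lemma values_tf_right_adjoint : (forall A, torsion_free (bhom s A)) ->
  right_adjoint_of_incl (@tf_wpc D) (bhom_functor s).
Proof.
move=> tfB; exists (fun A => conj (tfB A) (@bhom_wpc A)).
exists (fun (W : fullsub (@tf_wpc D)) A (u : ahom (sval W) A) =>
  bhom_map s u \oa sharp (proj2_sig W)).
split=> [[W tW] A|[W tW] [W' tW'] A A' f g u] /=.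
- exists (fun v : ahom W (bhom s A) => evX A \oa v) => [u|v].
    by apply/(@ahomP D W A) => w; rewrite !ahomE evXE bhom_mapE sharpX.
  apply/(@ahomP D W (bhom s A)) => w; apply/(@ahomP D (Int D) A) => F.
  rewrite ahomE bhom_mapE ahomE.
  (* In [F], [v] applied to the values of [sharp tW w] and the action on [v w] are homomorphisms
     into the torsion-free Hom(Int(D), A) with the same image of X. *)
  rewrite -(Int_act_evX (v w)); congr (evX A _).
  apply: (@Int_agree D (bhom s A) (v \oa (sharp tW w : ahom (Int D) W))
    (Int_act (v w)) F (tfB A)).
  by rewrite ahomE sharpX Int_actX.
- apply/(@ahomP D W' (bhom s A')) => w; apply/(@ahomP D (Int D) A') => F.
  by rewrite /= -(sharp_comp tW tW').
Qed.

(** The transpose of [u] is a |-> u(X (.) a). Conversely x (.) a must go to x evaluated at [v a],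
    which [sharp] provides in [W]. *)
Lemma values_tf_left_adjoint : (forall A, torsion_free (odot s A)) ->
  left_adjoint_of_incl (@tf_wpc D) (odot_functor s).
Proof.
move=> tfO; exists (fun A => conj (tfO A) (@odot_wpc A)).
exists (fun A (W : fullsub (@tf_wpc D)) (u : ahom (odot s A) (sval W)) =>
  u \oa (evX _ \oa odot_unit A)).
split=> [A [W tW]|A A' [W tW] [W' tW'] f g u] /=.
- exists (fun v : ahom A W => odot_lift (sharp tW \oa v)) => [u|v].
    apply: (@odot_ext A W) => x a.
    rewrite odot_liftE ahomE !ahomE evXE odot_unitE.
    apply: (@Int_agree D W (sharp tW (u (odot_gen s X a)) : ahom _ W)
      (u \oa (odot_unit A a : ahom (Int D) _)) x (proj1 tW)).
    exact: sharpX.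
  by apply/(@ahomP D A W) => a;
    rewrite !ahomE evXE odot_unitE odot_liftE sharpX.
- apply/(@ahomP D A' W') => a; rewrite !ahomE !evXE !odot_unitE.
  by congr (g (u _)); exact: odot_mapE.
Qed.

Lemma adjoints_of_values_tf : values_torsion_free s -> adjoints_of_inclusion s.
Proof.
move=> tfs; split; [apply: values_tf_right_adjoint => A |
  apply: values_tf_left_adjoint => A]; by have [] := tfs A.
Qed.

Lemma odot_tf A : torsion_free (bhom s (odot s A)) -> torsion_free (odot s A).
Proof.
set P := odot s A => tfB.
(* [sg] sends x (.) a to G |-> (G o x) (.) a; it is a section of [evX], hence injective. *)
pose sg : ahom P (bhom s P) :=
  odot_lift (sharp (conj tfB (@bhom_wpc P)) \oa odot_unit A).
have sgK z : evX P (sg z) = z.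
  have /ahomP/(_ z) // : evX P \oa sg = ahom_id P.
  apply: odot_ext => x a; rewrite ahomE odot_liftE !ahomE.
  rewrite -[RHS]odot_unitE -[RHS]Int_act_evX; congr (evX _ _).
  by apply: (Int_agree _ tfB); rewrite sharpX Int_actX.
move=> d z d0 dz; rewrite -[z]sgK.
suff -> : sg z = 0 by exact: ahom0.
by apply: (tfB d) => //; rewrite -(ahomC sg) -ahomM dz ahom0.
Qed.

End Compatible.

(** Being an adjoint of the inclusion includes having values in the subcategory. *)
Lemma adjoints_values_tf (D : idomainType) (s : biring D (Int D)) :
  adjoints_of_inclusion s -> values_torsion_free s.
Proof.
by case=> -[tfB _] [tfO _] A; split; [exact: (tfB A).1 | exact: (tfO A).1].
Qed.

(** * Principal and maximal ideals, residue classes and prime divisors *)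

Section Ideals.
Variable D : idomainType.
Implicit Types (a b x y : D) (P : D -> Prop).

Section OfProp.
Variable P : D -> Prop.
Hypotheses (P1 : ~ P 1) (P0 : P 0).
Hypothesis PB : forall x y, P x -> P y -> P (x - y).
Hypothesis PM : forall a x, P x -> P (a * x).

Definition ideal_pred : {pred D} := fun x => `[< P x >].

Lemma ideal_predP x : reflect (P x) (x \in ideal_pred).
Proof. exact: asboolP. Qed.

Fact ideal_pred_closed : idealr_closed ideal_pred.
Proof.
split=> [||a x y /ideal_predP Px /ideal_predP Py]; first exact/ideal_predP.
  exact/ideal_predP.
apply/ideal_predP; rewrite -[y]opprK -(sub0r y); apply: PB; first exact: PM.
exact: PB.
Qed.
HB.instance Definition _ := isIdealr.Build D ideal_pred ideal_pred_closed.

Lemma idealr_of_prop : exists I : idealr D, forall x, x \in I <-> P x.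
Proof. by exists ideal_pred => x; split=> /ideal_predP. Qed.

End OfProp.

(** [is_pid] covers the proper ideals; the unit ideal is generated by 1. *)
Lemma pid_generator P : is_pid D -> P 0 ->
  (forall x y, P x -> P y -> P (x - y)) -> (forall a x, P x -> P (a * x)) ->
  exists a, forall x, P x <-> exists y, x = a * y.
Proof.
move=> pidD P0 PB PM; have [P1|P1] := pselect (P 1).
  exists 1 => x; split=> _; first by exists x; rewrite mul1r.
  by rewrite -[x]mulr1; exact: PM.
have [I IP] := idealr_of_prop P1 P0 PB PM; have [a aI] := pidD I.
by exists a => x; rewrite -IP.
Qed.

Lemma exists_maximal_ideal a : (forall b, a * b <> 1) ->
  exists m : idealr D, maximal_ideal m /\ a \in m.
Proof.
move=> aN1; pose Q (S : set D) := [/\ forall x y, S x -> S y -> S (x - y),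
  forall b x, S x -> S (b * x), ~ S 1 & forall x, S x -> S a].
have [F FQ Ftot|A [[AB AM A1 Aa] Amax]] := @Zorn_bigcup D Q.
  have comb x y : (\bigcup_(S in F) S)%classic x ->
      (\bigcup_(S in F) S)%classic y -> exists S, [/\ F S, S x & S y].
    move=> [S FS Sx] [T FT Ty]; have [ST|TS] := Ftot _ _ FS FT.
      by exists T; split=> //; exact: ST.
    by exists S; split=> //; exact: TS.
  split=> [x y Fx Fy|b x [S FS Sx]|[S FS S1]|x [S FS Sx]].
  - have [S [FS Sx Sy]] := comb _ _ Fx Fy; exists S => //.
    by have [SB _ _ _] := FQ _ FS; exact: SB.
  - by exists S => //; have [_ SM _ _] := FQ _ FS; exact: SM.
  - by have [_ _ SN1 _] := FQ _ FS; exact: SN1.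
  - by exists S => //; have [_ _ _ Sa] := FQ _ FS; exact: Sa Sx.
have Qa : Q (fun x => exists y, x = a * y).
  split=> [_ _ [x ->] [y ->]|b _ [x ->]|[b ab]|_ _].
  - by exists (x - y); rewrite mulrBr.
  - by exists (b * x); rewrite mulrCA.
  - exact: aN1 (esym ab).
  - by exists 1; rewrite mulr1.
(* Otherwise [A] is empty, hence strictly contained in the principal ideal of [a]. *)
have {}Aa : A a.
  apply: contrapT => NAa; apply: (Amax _ _ Qa); split.
    by move=> x Ax; case: NAa; exact: Aa Ax.
  by move=> sub; apply/NAa/sub; exists 1; rewrite mulr1.
have A0 : A 0 by rewrite -(subrr a); exact: AB.
have [m mA] := idealr_of_prop A1 A0 AB AM.
exists m; split; last exact/mA.
move=> J mJ x Jx; apply/mA; apply: contrapT => NAx.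
apply: (Amax (fun y => y \in J)); first split.
- by move=> y Ay; apply: mJ; exact/mA.
- by move=> sub; apply/NAx/sub.
- split=> [y z|b y||y _].
  + exact: rpredB.
  + exact: idealMr.
  + by rewrite idealr1.
  + by apply: mJ; exact/mA.
Qed.

(** Otherwise the [u * a + v] with [v] in [m] form a proper ideal containing [m] and [a], against
    maximality. *)
Lemma maximal_ideal_inv (m : idealr D) a : maximal_ideal m -> a \notin m ->
  exists u v, v \in m /\ u * a + v = 1.
Proof.
move=> maxm am; apply: contrapT => N.
pose P x := exists u v, v \in m /\ x = u * a + v.
have [||x y [u [v [vm ->]]] [u' [v' [vm' ->]]]|b x [u [v [vm ->]]]|J JP] :=
  @idealr_of_prop P.
- by move=> [u [v [vm e]]]; apply: N; exists u, v.
- by exists 0, 0; rewrite idealr0 mul0r addr0.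
- exists (u - u'), (v - v'); rewrite rpredB //; split=> //.
  by rewrite mulrBl opprD addrACA.
- by exists (b * u), (b * v); rewrite idealMr // mulrDr mulrA.
case/negP: am; apply: (maxm J) => [x xm|]; apply/JP.
  by exists 0, x; rewrite mul0r add0r.
by exists 1, 0; rewrite idealr0 mul1r addr0.
Qed.

Lemma finite_residues (m : idealr D) : finite_set [set: {ideal_quot m}] ->
  exists rs : seq D, (forall r, r \in rs -> r \notin m) /\
    (forall x, x \in m \/ exists2 r, r \in rs & x - r \in m).
Proof.
move=> /finite_seqP[l lE].
exists [seq r <- [seq repr q | q <- l] | r \notin m]; split=> [r|x].
  by rewrite mem_filter => /andP[].
have [xm|xm] := boolP (x \in m); [by left | right].
pose q := (\pi_{ideal_quot m} x)%qT.
have xq : x - repr q \in m by rewrite Quotient.idealrBE reprK.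
exists (repr q) => //; rewrite mem_filter map_f; last first.
  have : [set: {ideal_quot m}]%classic q by [].
  by rewrite lE.
rewrite andbT; apply: contra xm => qm.
by rewrite -(subrK (repr q) x) rpredD.
Qed.

(** [p] generates a maximal ideal containing [a], and [rs] represents its nonzero residue
    classes. *)
Lemma pid_prime_divisor a : is_pid D -> finite_residue_fields D ->
  (forall b, a * b <> 1) -> exists (p : D) (rs : seq D),
  [/\ exists b, a = p * b, forall b, p * b <> 1,
      forall r, r \in rs -> exists u v, u * r + p * v = 1
    & forall x, exists2 r, r \in 0 :: rs & exists y, x - r = p * y].
Proof.
move=> pidD finD aN1; have [m [maxm am]] := exists_maximal_ideal aN1.
have [p pm] := pidD m; have [rs [rsm rsP]] := finite_residues (finD _ maxm).
exists p, rs; split=> [|b pb|r /rsm rm|x]; first exact/pm.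
- have : 1 \in m by apply/pm; exists b.
  by rewrite idealr1.
- have [u [v [/pm[w ->] e]]] := maximal_ideal_inv maxm rm.
  by exists u, w.
- have [xm|[r rrs xr]] := rsP x.
    by exists 0; rewrite ?inE ?eqxx // subr0; exact/pm.
  by exists r; rewrite ?inE ?rrs ?orbT //; exact/pm.
Qed.

End Ideals.

(** * Torsion-freeness over a PID with finite residue fields *)

Section TorsionFree.
Variables (D : idomainType) (s : biring D (Int D)).
Hypothesis s_compat : compatible s.
Hypotheses (pidD : is_pid D) (finD : finite_residue_fields D).
Local Notation X := (IntX D).
Local Notation sharpI := (sharp s_compat (Int_tf_wpc D)).
Implicit Types A : calg D.

Lemma Int_act_scale A (h : bhom s A) (d : D) :
  Int_act s_compat h (algmap (Int D) d * X) = algmap _ d * h.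
Proof. by rewrite ahomM (ahomC (Int_act s_compat h)) Int_actX. Qed.

Lemma bhom_prime_torsion A (p : D) (rs : seq D) (h : bhom s A) :
  p != 0 -> (forall r, r \in rs -> exists u v, u * r + p * v = 1) ->
  (forall x, exists2 r, r \in 0 :: rs & exists y, x - r = p * y) ->
  algmap (bhom s A) p * h = 0 -> h = 0.
Proof.
move=> p0 rs_inv rs_repr ph0.
pose q : {poly D} := 'X * \prod_(r <- rs) ('X - r%:P).
(* For each c, one factor of q(c) is divisible by [p], as 0 and [rs] meet all residue classes. *)
have [g pg] : exists g, algmap (Int D) p * g = Int_incl D q.
  apply: Int_dvd => // c; have [r rrs [y cr]] := rs_repr c.
  rewrite Int_inclE horner_map /=.
  suff [e ->] : exists e, q.[c] = p * e by exists e.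
  have -> : q = \prod_(r <- 0 :: rs) ('X - r%:P) by rewrite big_cons subr0.
  rewrite (big_rem r) //= hornerM hornerXsubC cr -mulrA.
  by exists (y * (\prod_(j <- rem r (0 :: rs)) ('X - j%:P)).[c]).
have g0 : colin s 0 g = 0.
  apply: (tf_inj (@self_tf D) p0); rewrite -(ahomC (colin s 0)) -ahomM pg.
  rewrite Int_inclX poly_eval_hom colinX // poly_eval_self.
  by rewrite hornerM hornerX mul0r mulr0.
pose Y : Int D := algmap (Int D) p * X.
have hY : Int_act s_compat h Y = 0 by rewrite Int_act_scale.
(* The zero of [bhom s A] is evaluation at 0. As [Y] acts on [h] as zero, [h] maps F o g o Y to
   F(g(0)), which is F(0) by [g0]. *)
have hY0 : Int_act s_compat h ((sharpI Y : ahom _ (Int D)) g) = 0.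
  apply/ahomP => F; rewrite Int_actE.
  rewrite -(sharp_comp _ (Int_tf_wpc D) (Int_tf_wpc D) (sharpI Y : ahom _ _)).
  rewrite -Int_actE hY; congr (algmap A _).
  apply: (@Int_agree D _ (colin s 0 \oa (sharpI g : ahom _ _)) (colin s 0)).
    exact: self_tf.
  by rewrite ahomE sharpX colinX.
(* Multiplied by [p], both sides become q(Y), whose first factor Y is [p] times X. *)
have gY : (sharpI Y : ahom _ (Int D)) g =
    X * \prod_(r <- rs) (Y - algmap (Int D) r).
  have := congr1 (sharpI Y : ahom _ (Int D)) pg; rewrite ahomM ahomC => pgY.
  apply: (tf_inj (@Int_tf D) p0); rewrite [LHS]pgY.
  rewrite Int_inclX poly_eval_hom sharpX ahomM poly_evalX -mulrA.
  congr (_ * (_ * _)); rewrite rmorph_prod; apply: eq_bigr => r _.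
  by rewrite rmorphB (ahomC (poly_eval Y)) [poly_eval Y 'X]poly_evalX.
move: hY0; rewrite gY ahomM Int_actX rmorph_prod.
under eq_bigr => r _ do
  rewrite rmorphB (ahomC (Int_act s_compat h)) hY sub0r.
(* The factors - r are removed one at a time: the remaining product [z] is killed by r and by [p],
   and u r + p v = 1. *)
elim: rs rs_inv {q rs_repr pg gY} => [|r rs IH] rs_inv.
  by rewrite big_nil mulr1.
rewrite big_cons mulrCA => rh; apply: IH => [t trs|].
  by apply: rs_inv; rewrite inE trs orbT.
set z := h * _ in rh *.
have [|u [v uv]] := rs_inv r; first by rewrite inE eqxx.
rewrite -[z]mul1r -(rmorph1 (algmap (bhom s A))) -uv rmorphD !rmorphM mulrDl.
rewrite -mulrA -[algmap _ r]opprK mulNr rh oppr0 mulr0 add0r.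
by rewrite mulrAC /z mulrA ph0 !mul0r.
Qed.

(** If the annihilator a D of [h] is proper, write a = p b by [pid_prime_divisor]. Then [p] kills b
    h, so b h = 0 and b = a y, whence p y = 1, a contradiction. *)
Lemma pid_bhom_tf A : torsion_free (bhom s A).
Proof.
move=> d h d0 dh; have [a aP] : exists a, forall x,
    algmap (bhom s A) x * h = 0 <-> exists y, x = a * y.
  apply: pid_generator => //; first by rewrite rmorph0 mul0r.
    by move=> x y xh yh; rewrite rmorphB mulrBl xh yh subr0.
  by move=> x y yh; rewrite rmorphM -mulrA yh mulr0.
have [[b ab]|aN1] := pselect (exists b, a * b = 1).
  by rewrite -[h]mul1r -(rmorph1 (algmap _)); apply/aP; exists b.
have a0 : a != 0.
  apply: contra_neq d0 => a0; have /aP[y ->] := dh.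
  by rewrite a0 mul0r.
have [|p [rs [[b apb] pN1 rs_inv rs_repr]]] :=
    pid_prime_divisor (a := a) pidD finD.
  by move=> b ab; apply: aN1; exists b.
have bh : algmap (bhom s A) b * h = 0.
  apply: (bhom_prime_torsion (p := p) _ rs_inv rs_repr).
    by apply: contra_neq a0 => p0; rewrite apb p0 mul0r.
  by rewrite mulrA -rmorphM -apb; apply/aP; exists 1; rewrite mulr1.
have /aP[y by_] := bh; case: (pN1 y); apply: (mulfI (x := a)) => //.
by rewrite mulr1 mulrCA -by_ -apb.
Qed.

Lemma pid_values_tf : values_torsion_free s.
Proof.
by move=> A; split; [|apply: odot_tf => //]; exact: pid_bhom_tf.
Qed.

End TorsionFree.

(** * A regular basis of Int(D) when D is not a field, and tensor products *)

Section NonField.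
Variables (D : idomainType) (t : D).
Hypotheses (t0 : t != 0) (t_nunit : forall b, t * b <> 1).
Local Notation K := {fraction D}.

Lemma nonunit_expr_neq k j : t ^+ (k + j.+1) != t ^+ k.
Proof.
apply/eqP => e; apply: (t_nunit (b := t ^+ j)).
by apply: (mulfI (expf_neq0 k t0)); rewrite mulr1 -exprS -exprD.
Qed.

(* Induction by f(X) |-> f(t X) - t^k f(X), which kills the coefficient of X^k
   and multiplies the one of X^n by t^n - t^k. *)
Lemma top_coef_values_from k j : exists (e : D) (ws : seq (D * D)), e != 0 /\
  forall f : {poly K}, (size f <= (k + j).+1)%N ->
    (forall i, (i < k)%N -> f`_i = 0) ->
    e%:F * f`_(k + j) = \sum_(w <- ws) w.1%:F * f.[w.2%:F].
Proof.
elim: j k => [|j IH] k.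
  exists 1, [:: (1, 1)]; rewrite oner_neq0 addn0; split=> // f fs f0.
  rewrite big_seq1 tofrac1 !mul1r (horner_coef_wide _ fs) big_ord_recr /=.
  by rewrite big1 ?add0r ?expr1n ?mulr1 // => i _; rewrite f0 ?mul0r.
have [e [ws [e0 ews]]] := IH k.+1.
exists (e * (t ^+ (k + j.+1) - t ^+ k)),
  ([seq (w.1, t * w.2) | w <- ws] ++ [seq (- t ^+ k * w.1, w.2) | w <- ws]).
split; first by rewrite mulf_neq0 // subr_eq0 nonunit_expr_neq.
move=> f fs f0.
pose g := \poly_(i < (k + j.+1).+1) ((t ^+ i - t ^+ k)%:F * f`_i).
have gs : (size g <= (k.+1 + j).+1)%N by rewrite addSnnS size_poly.
have g0 i : (i < k.+1)%N -> g`_i = 0.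
  rewrite ltnS leq_eqVlt coef_poly => /predU1P[->|ik].
    by rewrite subrr tofrac0 mul0r if_same.
  by rewrite f0 // mulr0 if_same.
have := ews g gs g0; rewrite addSnnS coef_poly ltnSn mulrA -tofracM => ->.
rewrite big_cat /= !big_map -big_split /=; apply: eq_bigr => w _.
rewrite mulNr tofracN [(_ ^+ k * _)%:F]tofracM mulNr -mulrA.
rewrite mulrCA -mulrBr; congr (_ * _).
rewrite horner_poly !(horner_coef_wide _ fs) mulr_sumr -sumrB.
apply: eq_bigr => i _; rewrite tofracB mulrBl mulrBl.
rewrite !(tofracM, tofracXn) exprMn; congr (_ - _); last by rewrite mulrA.
by rewrite -mulrA mulrCA.
Qed.

(** On an integer-valued [f] the right side lies in D, so [e] is a common denominator for the
    coefficients of X^n in degree at most n. *)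
Lemma top_coef_values n : exists (e : D) (ws : seq (D * D)), e != 0 /\
  forall f : {poly K}, (size f <= n.+1)%N ->
    e%:F * f`_n = \sum_(w <- ws) w.1%:F * f.[w.2%:F].
Proof.
have [e [ws [e0 ews]]] := top_coef_values_from 0 n.
by exists e, ws; split=> // f fs; exact: ews.
Qed.

Hypothesis pidD : is_pid D.

(** Multiplied by [e], the coefficients of X^n in degree at most n form an ideal of D, and [F]
    realises a generator. The ideal contains [e], coming from X^n, so [F] has degree exactly n. *)
Lemma Int_regular_elem n : exists F : Int D, size (intpoly_val F) = n.+1 /\
  forall G : Int D, (size (intpoly_val G) <= n.+1)%N ->
    exists c : D, (intpoly_val G)`_n = c%:F * (intpoly_val F)`_n.
Proof.
have [e [ws [e0 ews]]] := top_coef_values n.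
pose P (x : D) := exists G : Int D, (size (intpoly_val G) <= n.+1)%N /\
  e%:F * (intpoly_val G)`_n = x%:F.
have [||y x [G [Gs Gx]]|a aP] := pid_generator (P := P) pidD.
- by exists 0; rewrite size_poly0 coef0 mulr0 tofrac0.
- move=> x y [G [Gs Gx]] [H [Hs Hy]]; exists (G - H); split.
    by rewrite (leq_trans (size_polyD _ _)) // geq_max Gs size_polyN.
  by rewrite tofracB -Gx -Hy -mulrBr coefB.
- exists (algmap _ y * G); rewrite Int_algmapE; split.
    exact: leq_trans (size_scale_leq _ _) Gs.
  by rewrite coefZ mulrCA Gx tofracM.
have PX : P e.
  exists (Int_incl D 'X^n); rewrite Int_inclE map_polyXn size_polyXn.
  split=> //.
  by rewrite coefXn eqxx mulr1.
have [F [Fs Fa]] : P a by apply/aP; exists 1; rewrite mulr1.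
have eF : e%:F != 0 :> K by rewrite tofrac_eq0.
have Fn0 : (intpoly_val F)`_n != 0.
  have /aP[y ey] := PX; apply: contra_neq e0 => F0.
  move: Fa; rewrite F0 mulr0 -tofrac0 => /tofrac_inj a0.
  by rewrite ey -a0 mul0r.
exists F; split.
  apply/eqP; rewrite eqn_leq Fs ltnNge; apply: contra Fn0 => sF.
  by apply/eqP; exact: nth_default.
move=> G Gs; have [x Gx] : exists x : D, e%:F * (intpoly_val G)`_n = x%:F.
  exists (\sum_(w <- ws) w.1 * Int_ev w.2 G); rewrite ews // rmorph_sum /=.
  by apply: eq_bigr => w _; rewrite Int_evE tofracM.
have /aP[y xy] : P x by exists G.
by exists y; apply: (mulfI eF); rewrite Gx xy mulrC tofracM -Fa mulrCA.
Qed.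

Definition reg (n : nat) : Int D := projT1 (cid (Int_regular_elem n)).

Lemma size_reg n : size (intpoly_val (reg n)) = n.+1.
Proof. by have [] := projT2 (cid (Int_regular_elem n)). Qed.

Lemma reg_lead n (G : Int D) : (size (intpoly_val G) <= n.+1)%N ->
  exists c : D, (intpoly_val G)`_n = c%:F * (intpoly_val (reg n))`_n.
Proof. by have [_] := projT2 (cid (Int_regular_elem n)); apply. Qed.

Lemma reg_expand n (G : Int D) : (size (intpoly_val G) <= n)%N ->
  exists c : nat -> D, G = \sum_(i < n) algmap (Int D) (c i) * reg i.
Proof.
elim: n G => [|n IH] G Gs.
  exists (fun=> 0); rewrite big_ord0; apply: val_inj => /=.
  by move: Gs; rewrite size_poly_leq0 => /eqP.
have [c Gc] := reg_lead Gs.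
have [|c' Gc'] := IH (G - algmap (Int D) c * reg n).
  have H : intpoly_val (G - algmap (Int D) c * reg n) =
      intpoly_val G - c%:F *: intpoly_val (reg n) by rewrite -Int_algmapE.
  rewrite H; apply/leq_sizeP => i; rewrite leq_eqVlt => /predU1P[<-|ni].
    by rewrite coefB coefZ Gc subrr.
  rewrite coefB coefZ !nth_default ?mulr0 ?subr0 ?size_reg //.
  exact: leq_trans ni.
exists (fun i => if i == n then c else c' i).
rewrite big_ord_recr /= eqxx -[G](subrK (algmap (Int D) c * reg n)) Gc'.
by congr (_ + _); apply: eq_bigr => i _; rewrite ltn_eqF.
Qed.

(** The combination of values that computes [e] times the coefficient of X^n kills [reg i] for i < n
    but not [reg n], so it isolates a nonzero multiple of [q n]. Values lie in D and thus act on
    [Q]; coefficients lie in K. *)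
Lemma reg_independent (Q : calg D) n (q : nat -> Q) : torsion_free Q ->
  (forall a, \sum_(i < n) algmap Q (Int_ev a (reg i)) * q i = 0) ->
  forall i, (i < n)%N -> q i = 0.
Proof.
move=> tfQ; elim: n => // n IH q0.
have [e [ws [e0 ews]]] := top_coef_values n.
pose v i : D := \sum_(w <- ws) w.1 * Int_ev w.2 (reg i).
have vE i : (i <= n)%N -> (v i)%:F = e%:F * (intpoly_val (reg i))`_n.
  move=> ni; rewrite ews ?size_reg // rmorph_sum /=; apply: eq_bigr => w _.
  by rewrite Int_evE -tofracM.
have v0 i : (i < n)%N -> v i = 0.
  move=> ni; apply: tofrac_inj; rewrite vE 1?ltnW // nth_default ?size_reg //.
  by rewrite mulr0 tofrac0.
have vn : v n != 0.
  rewrite -tofrac_eq0 vE // mulf_neq0 ?tofrac_eq0 //.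
  have -> : (intpoly_val (reg n))`_n = lead_coef (intpoly_val (reg n)).
    by rewrite lead_coefE size_reg.
  by rewrite lead_coef_eq0 -size_poly_eq0 size_reg.
have qn : q n = 0.
  apply: (tfQ _ _ vn); transitivity (\sum_(i < n.+1) algmap Q (v i) * q i).
    rewrite big_ord_recr /= big1 ?add0r // => i _.
    by rewrite v0 ?rmorph0 ?mul0r.
  transitivity (\sum_(w <- ws) algmap Q w.1 *
      \sum_(i < n.+1) algmap Q (Int_ev w.2 (reg i)) * q i).
    under [RHS]eq_bigr => w _ do rewrite mulr_sumr.
    rewrite exchange_big; apply: eq_bigr => i _; rewrite rmorph_sum mulr_suml.
    by apply: eq_bigr => w _; rewrite rmorphM mulrA.
  by rewrite big1 // => w _; rewrite q0 mulr0.
move=> i; rewrite ltnS leq_eqVlt => /predU1P[->//|]; apply: IH => a.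
by have := q0 a; rewrite big_ord_recr /= qn mulr0 addr0.
Qed.

Lemma tens_suml (P Q : calg D) n (x : 'I_n -> P) (y : Q) :
  (\sum_(i < n) x i) ⊗ y = \sum_(i < n) x i ⊗ y.
Proof.
elim: n x => [|n IH] x; first by rewrite !big_ord0 tens0l.
by rewrite !big_ord_recr tensDl IH.
Qed.

Lemma tensor_expand (Q : calg D) (z : tensor (Int D) Q) :
  exists n (q : nat -> Q), z = \sum_(i < n) reg i ⊗ q i.
Proof.
(* All large lengths are allowed, so that two expansions can be added at a common length. *)
suff [n nP] : exists n, forall m, (n <= m)%N ->
    exists q : nat -> Q, z = \sum_(i < m) reg i ⊗ q i.
  by exists n; exact: nP.
have [ps ->] := tensor_sumP z; elim: ps => [|[x y] ps [n nP]].
  exists 0 => m _; exists (fun=> 0); rewrite big_nil big1 // => i _.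
  exact: tens0r.
exists (maxn n (size (intpoly_val x))) => m; rewrite geq_max => /andP[nm xm].
have [q psq] := nP m nm; have [c xc] := reg_expand xm.
exists (fun i => algmap Q (c i) * y + q i).
transitivity (x ⊗ y + \sum_(p <- ps) p.1 ⊗ p.2); first by rewrite big_cons.
rewrite psq xc.
rewrite tens_suml -big_split /=; apply: eq_bigr => i _.
by rewrite tensDr tensZl tensZr.
Qed.

(** Evaluating the first tensor factor at every a reduces the vanishing of the coordinates to
    [reg_independent]. *)
Lemma tensor_tf (Q : calg D) :
  torsion_free Q -> torsion_free (tensor (Int D) Q).
Proof.
move=> tfQ d z d0; have [n [q ->]] := tensor_expand z => dz.
suff q0 i : (i < n)%N -> q i = 0.
  by rewrite big1 // => i _; rewrite q0 // tens0r.
apply: reg_independent i => // a; apply: (tfQ d) => //.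
have := congr1 (tpair (ahom_unit Q \oa Int_ev a) (ahom_id Q)) dz.
rewrite ahomM ahomC ahom0 rmorph_sum => sz0; rewrite -[RHS]sz0; congr (_ * _).
by apply: eq_bigr => i _; rewrite tpairE.
Qed.

(** Write z as the sum of the [reg i ⊗ g i]. For fixed b, the sum of the g_i(b) reg_i has all its
    values divisible by [d], so it equals d y. Comparing coordinates, [d] divides each g_i(b), hence
    each g_i in Int(D). *)
Lemma tensor_dvd (d : D) (z : tensor (Int D) (Int D)) : d != 0 ->
  (forall a b, exists e : D, tpair (Int_ev a) (Int_ev b) z = d * e) ->
  exists y, algmap _ d * y = z.
Proof.
move=> d0; have [n [g ->]] := tensor_expand z => zd.
have gd i : exists e : Int D, (i < n)%N -> algmap (Int D) d * e = g i.
  have [ni|] := boolP (i < n)%N; last by exists 0.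
  suff [e eg] : exists e, algmap (Int D) d * e = g i by exists e.
  apply: Int_dvd => // b; rewrite Int_evE.
  pose H : Int D := \sum_(j < n) algmap (Int D) (Int_ev b (g j)) * reg j.
  have Hs : (size (intpoly_val H) <= n)%N.
    apply: (big_ind (fun F : Int D => (size (intpoly_val F) <= n)%N)).
    - by rewrite size_poly0.
    - move=> F G Fs Gs; apply: leq_trans (size_polyD _ _) _.
      by rewrite geq_max Fs.
    - move=> j _; rewrite Int_algmapE (leq_trans (size_scale_leq _ _)) //.
      by rewrite size_reg.
  have [a|y Hy] := Int_dvd (F := H) d0.
    have [e ze] := zd a b; exists e; rewrite Int_evE -ze; congr (_%:F).
    rewrite /H !rmorph_sum; apply: eq_bigr => j _.
    by rewrite tpairE ahomM ahomC mulrC.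
  have [|c yc] := @reg_expand n y.
    by rewrite -(size_scale _ (_ : d%:F != 0)) ?tofrac_eq0 // -Int_algmapE Hy.
  exists (c i); congr (_%:F); apply/eqP; rewrite -subr_eq0; apply/eqP.
  pose q j : calg_self D := Int_ev b (g j) - d * c j.
  apply: (reg_independent (q := q) (@self_tf D) _ ni) => a.
  have := congr1 (Int_ev a) Hy; rewrite yc ahomM ahomC /H !rmorph_sum.
  rewrite mulr_sumr => /eqP; rewrite eq_sym -subr_eq0 -sumrB => /eqP s0.
  rewrite -[RHS]s0.
  apply: eq_bigr => j _; rewrite !ahomM !ahomC /= mulrBr.
  by congr (_ - _); rewrite mulrC // mulrA.
have [e eg] := choice gd.
exists (\sum_(i < n) reg i ⊗ e i); rewrite mulr_sumr.
by apply: eq_bigr => i _; rewrite -tensZr eg.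
Qed.

Lemma tensor_dvd_closed : dvd_closed (tensor (Int D) (Int D)).
Proof.
move=> z d p d0 dp; apply: tensor_dvd => // a b.
rewrite poly_eval_hom poly_eval_self; exact: dp.
Qed.

End NonField.

(** * Existence of the compatible biring structure *)

Section Existence.
Variable D : idomainType.
Local Notation I := (Int D).
Local Notation X := (IntX D).

Lemma tf_of_injective (P Q : calg D) (f : ahom P Q) :
  injective f -> torsion_free Q -> torsion_free P.
Proof.
move=> f_inj tfQ d a d0 da; apply: f_inj; rewrite ahom0.
by apply: (tfQ d) => //; rewrite -(ahomC f) -ahomM da ahom0.
Qed.

Lemma tswapK (P Q : calg D) : cancel (tswap P Q) (tswap Q P).
Proof.
move=> z; have /ahomP/(_ z) // : tswap Q P \oa tswap P Q = ahom_id _.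
by apply: tensor_ext => x y; rewrite !tensE.
Qed.

Section FromTensor.
Hypotheses (tfII : torsion_free (tensor I I)) (wII : wpc (tensor I I)).
Hypothesis tfIII : torsion_free (tensor I (tensor I I)).

Let tfI := @Int_tf D.
Let tfD := @self_tf D.

(** Coassociativity is an equation in [tensor I (tensor I I)], distributivity one in this other
    bracketing. *)
Let tfII_I : torsion_free (tensor (tensor I I) I).
Proof. exact: tf_of_injective (can_inj (@tswapK _ _)) tfIII. Qed.

Let coadd : ahom I (tensor I I) := projT1 (cid (wII (X ⊗ 1 + 1 ⊗ X))).
Let comul : ahom I (tensor I I) := projT1 (cid (wII (X ⊗ X))).
Let coopp : ahom I I := projT1 (cid (Int_wpc (- X))).

Let coaddX : coadd X = X ⊗ 1 + 1 ⊗ X.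
Proof. by rewrite /coadd; case: cid. Qed.
Let comulX : comul X = X ⊗ X.
Proof. by rewrite /comul; case: cid. Qed.
Let cooppX : coopp X = - X.
Proof. by rewrite /coopp; case: cid. Qed.

Let cE := (coaddX, comulX, cooppX, @Int_evX, @tensE).

Let coaddA : tassoc I I I \oa tmap coadd (ahom_id I) \oa coadd
  = tmap (ahom_id I) coadd \oa coadd.
Proof.
apply: Int_ext => //; rewrite !cE !ahomD !tmapE !coaddX !ahom_idE !ahom1.
by rewrite tensDl tensDr ahomD -(tens1 I I) !tassocE addrA tens1.
Qed.

Let coaddC : tswap I I \oa coadd = coadd.
Proof. by apply: Int_ext => //; rewrite !cE ahomD !cE addrC. Qed.

Let coadd0 : tpair (ahom_unit I \oa Int_ev 0) (ahom_id I) \oa coadd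
  = ahom_id I.
Proof.
apply: Int_ext => //; rewrite !cE ahomD !cE !ahom1 rmorph0.
by rewrite mul0r add0r rmorph1 mul1r.
Qed.

Let coaddN : tpair coopp (ahom_id I) \oa coadd = ahom_unit I \oa Int_ev 0.
Proof.
apply: Int_ext => //; rewrite !cE ahomD !cE !ahom1 rmorph0.
by rewrite mulr1 mul1r addNr.
Qed.

Let comulA : tassoc I I I \oa tmap comul (ahom_id I) \oa comul
  = tmap (ahom_id I) comul \oa comul.
Proof. by apply: Int_ext => //; rewrite !cE. Qed.

Let comulC : tswap I I \oa comul = comul.
Proof. by apply: Int_ext => //; rewrite !cE. Qed.

Let comul1 : tpair (ahom_unit I \oa Int_ev 1) (ahom_id I) \oa comul
  = ahom_id I.
Proof. by apply: Int_ext => //; rewrite !cE rmorph1 mul1r. Qed.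

Let comulDl : tmap coadd (ahom_id I) \oa comul
  = tpair (tmap (tinl I I) (ahom_id I) \oa comul)
          (tmap (tinr I I) (ahom_id I) \oa comul) \oa coadd.
Proof.
apply: Int_ext => //; rewrite !cE ahomD !cE !ahom1 mulr1 mul1r.
by rewrite tensDl.
Qed.

Let colinD (b c : D) : Int_ev (b + c)
  = tpair (Int_ev b) (Int_ev c) \oa coadd.
Proof.
by apply: Int_ext => //; rewrite !cE ahomD !cE !ahom1 mulr1 mul1r.
Qed.

Let colinM (b c : D) : Int_ev (b * c)
  = tpair (Int_ev b) (Int_ev c) \oa comul.
Proof. by apply: Int_ext => //; rewrite !cE. Qed.

Lemma compatible_biring_of_tensor :
  exists s : biring D (Int D), compatible s.
Proof.
exists (Biring coaddA coaddC coadd0 coaddN comulA comulC comul1 comulDl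
  colinD colinM); split=> [||b] /=; apply: poly_ext; rewrite !ahomE.
- by rewrite poly_coaddX ahomD !tmapE !ahom1 coaddX.
- by rewrite poly_comulX tmapE comulX.
- by rewrite poly_colinX Int_evX.
Qed.

End FromTensor.

Lemma field_tf (T : calg D) : (forall d : D, d != 0 -> exists b, d * b = 1) ->
  torsion_free T.
Proof.
move=> invD d a /invD[b db] da; rewrite -[a]mul1r -(rmorph1 (algmap T)) -db.
by rewrite rmorphM mulrAC da mul0r.
Qed.

Lemma field_dvd_closed (T : calg D) :
  (forall d : D, d != 0 -> exists b, d * b = 1) -> dvd_closed T.
Proof.
move=> invD t d p /invD[b db] _; exists (algmap T b * poly_eval t p).
by rewrite mulrA -rmorphM db rmorph1 mul1r.
Qed.

Lemma pid_compatible_biring : is_pid D ->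
  exists s : biring D (Int D), compatible s.
Proof.
move=> pidD.
(* The regular basis is built from a nonzero nonunit [t], which exists exactly when D is not a
   field. *)
have [invD|] := pselect (forall d : D, d != 0 -> exists b, d * b = 1).
  apply: compatible_biring_of_tensor; try exact: field_tf.
  by apply: dvd_closed_wpc; [exact: field_tf | exact: field_dvd_closed].
move=> /existsNP[t /not_implyP[t0 tN]].
have tU b : t * b <> 1 by move=> tb; apply: tN; exists b.
have tfII : torsion_free (tensor I I).
  exact: (tensor_tf t0 tU pidD (@Int_tf D)).
apply: compatible_biring_of_tensor => //.
  exact: (dvd_closed_wpc tfII (tensor_dvd_closed t0 tU pidD)).
exact: (tensor_tf t0 tU pidD tfII).
Qed.

End Existence.

Theorem theorem8 (D : idomainType) :
  (forall s : biring D (Int D), compatible s ->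
     (adjoints_of_inclusion s <-> values_torsion_free s)) /\
  (is_pid D -> finite_residue_fields D ->
     (exists s : biring D (Int D), compatible s) /\
     (forall s : biring D (Int D), compatible s ->
        values_torsion_free s /\ adjoints_of_inclusion s)).
Proof.
split=> [s s_compat|pidD finD].
  by split; [exact: adjoints_values_tf | exact: adjoints_of_values_tf].
split=> [|s s_compat]; first exact: pid_compatible_biring.
have tfs := pid_values_tf s_compat pidD finD.
by split=> //; exact: adjoints_of_values_tf.
Qed.
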